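(* Let $d>1$ be an integer, $m\ge1$ real, $\beta=\frac{1}{dm+2}$, and let $(X^n)_{n\ge0}$ be $\mathrm{CM}(m,d)$-distributed started from $0\in\mathbb{Z}^d$, with probability mass functions $p(k,n)=\mathbf{P}\{X^n=k\}$. There exists a constant $C=C(d,m)>0$ such that: (i) for all $k\in\mathbb{Z}^d$ and $n\in\mathbb{N}$, $p(k,n)\le Cn^{-d\beta}$; (ii) for all $r>0$ and $n\in\mathbb{N}$, $\displaystyle\sum_{k\in\mathbb{Z}^d\cap B_{rn^\beta}^c}p(k,n)\le C\exp(-r/C)$; (iii) for all $r>0$ and $n\in\mathbb{N}$, $[p(\cdot,n)]_{\mathrm{TV}(B_{rn^\beta}\cap\mathbb{Z}^d)}\le Cr^{d-1}n^{-\beta}$. Here $B_{\rho}$ denotes the Euclidean ball of radius $\rho$ in $\mathbb{R}^d$ centred at $0$ and $B_\rho^c$ its complement.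
   Context: $\mathbb{N}=\{1,2,\dots\}$. $\ell\sim k$ in $\mathbb{Z}^d$ means $k-\ell=\pm e_i$ for some standard basis vector $e_i$. $(X^n)_{n\ge0}$ is $\mathrm{CM}(m,d)$-distributed started from $0$ if its probability mass functions $p(k,n)=\mathbf{P}\{X^n=k\}$ satisfy $p(k,0)=\mathbf 1_{\{k=0\}}$ and, for all $k\in\mathbb{Z}^d$, $n\ge0$, $$p(k,n+1)=p(k,n)+\frac1{2d}\sum_{\ell\sim k}\bigl[p(\ell,n)^{m+1}-p(k,n)^{m+1}\bigr].$$ (For integer $m$: $X^{n+1}=X^n+E^n$ if $X^n$ equals all of $m$ independent copies of itself, and $X^{n+1}=X^n$ otherwise, with $E^n$ i.i.d. uniform on $\{\pm e_i\}$, $X^0=0$.) For $q:\mathbb{Z}^d\to\mathbb{R}$ and $D\subset\mathbb{Z}^d$, the discrete total variation is $[q]_{\mathrm{TV}(D)}=\frac12\sum_{\{u,v\in D:\,u\sim v\}}|q(v)-q(u)|$. *)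

(* Defs.v *)
From HB Require Import structures.
From mathcomp Require Import all_boot all_order all_algebra.
From mathcomp Require Import all_classical all_reals all_analysis.

Set Implicit Arguments.
Unset Strict Implicit.
Unset Printing Implicit Defensive.

Import Order.TTheory GRing.Theory Num.Theory.
Import numFieldNormedType.Exports.

Local Open Scope classical_set_scope.
Local Open Scope ring_scope.

Definition lattice (d : nat) := 'rV[int]_d.

(* delta_mx 0 i is the standard basis vector e_i *)
Definition lattice_neighbor (d : nat) (l k : lattice d) : Prop :=
  exists i : 'I_d, k - l = delta_mx 0 i \/ k - l = - delta_mx 0 i.

(* The library's norm on row vectors is the sup norm, hence this definition. *)
Definition euclidean_norm (R : realType) (d : nat) (x : 'rV[R]_d) : R :=
  Num.sqrt (\sum_(i < d) x 0 i ^+ 2).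

Definition euclidean_ball (R : realType) (d : nat) (rho : R) : set 'rV[R]_d :=
  [set x | euclidean_norm x < rho].

Arguments euclidean_ball {R} d rho.

Definition lattice_points (R : realType) (d : nat) (A : set 'rV[R]_d) :
    set (lattice d) :=
  [set k | A (map_mx intr k)].

(* The sum ranges over ordered pairs, so each edge is counted twice and the
   factor 1/2 compensates. D may be infinite, hence the extended-real value. *)
Definition discrete_TV (R : realType) (d : nat) (D : set (lattice d))
    (q : lattice d -> R) : \bar R :=
  ((2^-1)%:E *
   \esum_(uv in [set uv : lattice d * lattice d |
                   [/\ D uv.1, D uv.2 & lattice_neighbor uv.1 uv.2]])
      `|q uv.2 - q uv.1|%:E)%E.

Definition lattice_pmf (R : realType) (dsp : measure_display)
    (T : measurableType dsp) (P : probability T R) (d : nat)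
    (X : nat -> T -> lattice d) (k : lattice d) (n : nat) : R :=
  fine (P (X n @^-1` [set k])).

(* The first clause says that each X n is a random variable for the discrete
   sigma-algebra on the lattice. The sum over neighbors has finite support,
   so that the finitely supported sum is the genuine one. *)
Definition CM_distributed (R : realType) (m : R) (d : nat)
    (dsp : measure_display) (T : measurableType dsp) (P : probability T R)
    (X : nat -> T -> lattice d) : Prop :=
  let p := lattice_pmf P X in
  [/\ forall n (A : set (lattice d)), measurable (X n @^-1` A),
      forall k, p k 0%N = (k == 0)%:R
    & forall k n, p k n.+1 = p k n + (2 * d%:R)^-1 *
        \sum_(l \in [set l | lattice_neighbor l k])
           (p l n `^ (m + 1) - p k n `^ (m + 1))].

Definition CM_beta (R : realType) (d : nat) (m : R) : R := (d%:R * m + 2)^-1.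

(* Main.v *)
(** The scheme is a discrete porous medium equation, monotone as long as the
    solution is at most 1/2; from time 1 on the solution is at most 1/4.
    Aleksandrov reflection in the hyperplanes [x_i = c/2] and [x_i + x_j = c]
    shows that it increases towards the origin, so unit mass gives [p(k, n) <=
    C |k|^-d] at all times.  This controls the solution on the boundary of a
    ball of radius of order [n^beta], inside which an explicit separable
    supersolution bounds it by [C n^(-d beta)].  Given this sup bound, the
    exponential moment of parameter of order [n^-beta] satisfies a Gronwall
    recursion, which yields the tails; and since the solution is unimodal along
    every coordinate line, its variation on a line is at most a constant times
    its supremum, so it remains to count the lines that meet the ball. *)
Require Import Defs.
From HB Require Import structures.
From mathcomp Require Import all_boot all_order all_algebra.
From mathcomp Require Import all_classical all_reals all_analysis.
From mathcomp Require Import zify ring lra.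

Set Implicit Arguments.
Unset Strict Implicit.
Unset Printing Implicit Defensive.

Import Order.TTheory GRing.Theory Num.Theory.
Import numFieldNormedType.Exports.

Local Open Scope classical_set_scope.
Local Open Scope ring_scope.

(** * Power and exponential inequalities *)

Section real_powers.
Variable R : realType.
Implicit Types m g p s c x y t : R.

(** Young's inequality for the product of [t] and 1, with conjugate exponents [p] and [p / (p - 1)];
    [p = 1] has no finite conjugate. *)
Lemma bernoulli_powR p t : 1 <= p -> 0 <= t -> 1 + p * (t - 1) <= t `^ p.
Proof.
move=> p1 t0; have p0 : 0 < p by lra.
have [->|pN1] := eqVneq p 1; first by rewrite powRr1//; lra.
have q0 : 0 < p - 1 by rewrite subr_gt0 lt_neqAle eq_sym pN1.
have := @conjugate_powR R t 1 p (p / (p - 1)) t0 ler01 p0 (divr_gt0 p0 q0).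
have -> : p^-1 + (p / (p - 1))^-1 = 1 by field; rewrite !gt_eqF.
move=> /(_ erefl); rewrite powR1 mulr1 => h.
have : t * p <= (t `^ p / p + 1 / (p / (p - 1))) * p by rewrite ler_pM2r.
have -> : (t `^ p / p + 1 / (p / (p - 1))) * p = t `^ p + (p - 1).
  by field; rewrite !gt_eqF.
lra.
Qed.

(** The tangent at [y] lies below the convex power, and its slope $(m+1)y^m$ is at most 1 because
    $m+1\le2^m$. This is what makes the scheme monotone. *)
Lemma powR_sub_le m x y : 1 <= m -> 0 <= x -> x <= y -> y <= 2^-1 ->
  y `^ (m + 1) - x `^ (m + 1) <= y - x.
Proof.
move=> m1 x0 xy y2; have y0 : 0 <= y by lra.
have m0 : 0 < m by lra.
have [yE|yN] := eqVneq y 0.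
  have -> : x = 0 by lra.
  by rewrite yE !subrr.
have yp : 0 < y by rewrite lt_neqAle eq_sym yN.
have ym : (m + 1) * y `^ m <= 1.
  have h2 : (m + 1) <= 2 `^ m.
    by have := @bernoulli_powR m 2 m1 (ler0n _ 2); lra.
  have : (m + 1) * y `^ m <= 2 `^ m * (2^-1) `^ m.
    apply: ler_pM => //; [lra|exact: powR_ge0|].
    by rewrite ge0_ler_powR ?nnegrE//; lra.
  by rewrite -powRM ?invr_ge0// divff// powR1.
have tE : x `^ (m + 1) = y `^ (m + 1) * (x / y) `^ (m + 1).
  by rewrite -powRM ?divr_ge0// [y * _]mulrC divfK.
have yE : y `^ (m + 1) = y * y `^ m.
  by rewrite -mulr_powRB1 ?addrK//; lra.
have m2 : 1 <= m + 1 by lra.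
have := @bernoulli_powR (m + 1) (x / y) m2 (divr_ge0 x0 y0).
move=> /(ler_wpM2l (powR_ge0 y (m + 1))); rewrite -tE yE.
have -> : y * y `^ m * (1 + (m + 1) * (x / y - 1)) =
   y * y `^ m - (m + 1) * y `^ m * (y - x) by field.
have := ler_wpM2r (_ : 0 <= y - x) ym; rewrite subr_ge0 => /(_ xy).
lra.
Qed.

(** Doubling both arguments in [powR_sub_le] gains $2^{m+1}\ge4$ on the left and 2 on the right. The
    spare factor 2 pays for the mirror image in [solution_reflection]. *)
Lemma powR_sub_le_half m x y : 1 <= m -> 0 <= x -> x <= y -> y <= 4^-1 ->
  2 * (y `^ (m + 1) - x `^ (m + 1)) <= y - x.
Proof.
move=> m1 x0 xy y4.
have := @powR_sub_le m (2 * x) (2 * y) m1; rewrite !powRM//; last lra.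
move=> h.
have h1 : 2 `^ (m + 1) * y `^ (m + 1) - 2 `^ (m + 1) * x `^ (m + 1) <=
   2 * y - 2 * x by apply: h; lra.
have h2 : 4 <= 2 `^ (m + 1) :> R.
  have -> : (4 : R) = 2 `^ 2 by rewrite powR_mulrn// expr2; ring.
  by apply: ler_powR; lra.
have h3 : 0 <= y `^ (m + 1) - x `^ (m + 1).
  by rewrite subr_ge0 ge0_ler_powR ?nnegrE//; lra.
have := ler_wpM2r h3 h2; lra.
Qed.

(* Supersolution property of the barrier's amplitude [B = s^(-1/m)], which
   solves [B' = - B^(m+1)] when [s' = m]. *)
Lemma powRN_step m s c : 0 < m -> 0 < s -> 0 <= c ->
  s `^ (- m^-1) - c * (s `^ (- m^-1)) `^ (m + 1) <= (s + m * c) `^ (- m^-1).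
Proof.
move=> m0 s0 c0.
have -> : (s `^ (- m^-1)) `^ (m + 1) = s `^ (- m^-1) / s.
  rewrite -powRrM mulrDr mulr1 mulNr mulVf ?gt_eqF// powRD ?(gt_eqF s0) ?implybT//.
  by rewrite powR_inv1 ?ltW// mulrC.
have -> : s + m * c = s * (1 + m * c / s) by field; rewrite gt_eqF.
have t0 : 0 <= m * c / s by rewrite divr_ge0 ?mulr_ge0// ltW.
rewrite powRM ?(ltW s0)//; last lra.
have -> : s `^ (- m^-1) - c * (s `^ (- m^-1) / s) =
  s `^ (- m^-1) * (1 - c / s) by ring.
apply: ler_wpM2l; first exact: powR_ge0.
(* What remains is $1-c/s\le\exp(-\ln(1+mc/s)/m)$, from $1+x\le e^x$ and $\ln(1+x)\le x$. *)
rewrite /powR gt_eqF; last lra.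
apply: le_trans (expR_ge1Dx _); rewrite lerD2l mulNr lerN2.
have h : ln (1 + m * c / s) <= m * c / s by apply: le_ln1Dx; lra.
apply: le_trans (ler_wpM2l _ h) _; first by rewrite invr_ge0 ltW.
by rewrite le_eqVlt; apply/orP; left; apply/eqP; field; rewrite !gt_eqF.
Qed.

(** From $(1+1/n)^g\ge1+g\ln(1+1/n)$ and $\ln(1+1/n)\ge1/(n+1)\ge1/(2n)$. The lost factor 2 buys
    validity on both sides of $g=1$. *)
Lemma powR_incr_ge n g : 0 < g -> (0 < n)%N ->
  g / 2 * n%:R `^ (g - 1) <= n.+1%:R `^ g - n%:R `^ g :> R.
Proof.
move=> g0 n0; have n0' : (0 < n%:R :> R) by rewrite ltr0n.
have n1 : (1 <= n%:R :> R) by rewrite ler1n.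
have -> : n.+1%:R = n%:R * (1 + n%:R^-1) :> R.
  by rewrite -natr1; field; rewrite gt_eqF.
have i0 : 0 < n%:R^-1 :> R by rewrite invr_gt0.
have ng0 : (n%:R != 0 :> R) by rewrite gt_eqF.
rewrite powRM ?ler0n ?addr_ge0 ?ler01 ?(ltW i0)//.
rewrite powRD ?ng0 ?implybT// powR_inv1 ?ler0n//.
have -> : g / 2 * (n%:R `^ g / n%:R) = n%:R `^ g * (g / (2 * n%:R)) :> R.
  by field.
rewrite -[X in _ <= _ - X]mulr1 -mulrBr; apply: ler_wpM2l; first exact: powR_ge0.
rewrite lerBrDl /powR gt_eqF; last lra.
apply: le_trans (expR_ge1Dx _); rewrite lerD2l ler_wpM2l ?(ltW g0)//.
have -> : 1 + n%:R^-1 = (1 - (n%:R + 1)^-1)^-1 :> R.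
  by field; do ?(apply/andP; split); rewrite gt_eqF//; lra.
have j1 : (n%:R + 1)^-1 <= 2^-1 :> R by rewrite lef_pV2 ?posrE; lra.
rewrite lnV ?posrE; last lra.
have : ln (1 - (n%:R + 1)^-1) <= - (n%:R + 1)^-1 :> R by apply: le_ln1Dx; lra.
have : (2 * n%:R)^-1 <= (n%:R + 1)^-1 :> R by rewrite lef_pV2 ?posrE; lra.
lra.
Qed.

(** The sum is at most $1/(1-x)+1/(1+x)=2/(1-x^2)$. Having no linear term, it makes the growth rate
    of exponential moments quadratic. *)
Lemma expR_add_expRN_le x : 0 <= x -> x <= 2^-1 ->
  expR x + expR (- x) <= 2 + 4 * x ^+ 2.
Proof.
move=> x0 x2.
have h1 : expR x <= (1 - x)^-1.
  rewrite -[x in expR x]opprK expRN lef_pV2 ?posrE ?expR_gt0//; last lra.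
  exact: expR_ge1Dx.
have h2 : expR (- x) <= (1 + x)^-1.
  rewrite expRN lef_pV2 ?posrE ?expR_gt0//; last lra.
  exact: expR_ge1Dx.
apply: le_trans (lerD h1 h2) _.
have -> : (1 - x)^-1 + (1 + x)^-1 = 2 / (1 - x ^+ 2).
  have ? : 1 - x != 0 by rewrite gt_eqF//; lra.
  have ? : 1 + x != 0 by rewrite gt_eqF//; lra.
  have ? : 1 - x ^+ 2 != 0.
    by rewrite (_ : 1 - x ^+ 2 = (1 - x) * (1 + x)) ?mulf_neq0//; ring.
  by field; do !(apply/andP; split).
have xx : x ^+ 2 <= 4^-1.
  by rewrite expr2; nra.
have xx0 : 0 <= x ^+ 2 by apply: sqr_ge0.
rewrite ler_pdivrMr; last lra.
nra.
Qed.

Lemma powRN_anti a x y : 0 <= a -> 0 < x -> x <= y -> y `^ (- a) <= x `^ (- a).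
Proof.
move=> a0 x0 xy; have y0 := lt_le_trans x0 xy.
rewrite !powRN lef_pV2 ?posrE ?powR_gt0//.
by apply: ge0_ler_powR; rewrite ?nnegrE ?(ltW x0) ?(ltW y0).
Qed.

End real_powers.

(** * The lattice and its reflections *)

Section lattice.
Variable d : nat.
Implicit Types (k l : lattice d) (i j : 'I_d).

Definition basis i : lattice d := delta_mx 0 i.

Lemma basisE i j : basis i 0 j = (j == i)%:R.
Proof. by rewrite mxE eqxx. Qed.

Lemma coordD k l i : (k + l) 0 i = k 0 i + l 0 i. Proof. by rewrite mxE. Qed.

Lemma coordN k i : (- k) 0 i = - k 0 i. Proof. by rewrite mxE. Qed.

Lemma coordZ (a : int) k i : (a *: k) 0 i = a * k 0 i.
Proof. by rewrite mxE. Qed.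

Definition coordE := (coordD, coordN, coordZ, basisE).

Lemma eq_lattice k l : (forall i, k 0 i = l 0 i) -> k = l.
Proof. by move=> kl; apply/rowP. Qed.

Definition signed_basis (x : 'I_d * bool) : lattice d :=
  if x.2 then basis x.1 else - basis x.1.

Lemma signed_basis_inj : injective signed_basis.
Proof.
move=> [i b] [j c] /rowP/(_ i); rewrite /signed_basis /=.
by case: b c => [] []; rewrite !coordE eqxx; case: eqVneq => [->|].
Qed.

Lemma neighborP l k :
  lattice_neighbor l k <-> exists x, l = k + signed_basis x.
Proof.
split=> [[i [] kl]|[[i []] ->]].
- exists (i, false); rewrite /signed_basis /= -/(basis i) in kl *.
  by rewrite -kl; apply/eq_lattice => j; rewrite !coordE; ring.
- exists (i, true); rewrite /signed_basis /=.
  by rewrite -[basis i]opprK -kl; apply/eq_lattice => j; rewrite !coordE; ring.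
- exists i; right; rewrite /signed_basis /= -/(basis i).
  by apply/eq_lattice => j; rewrite !coordE; ring.
- exists i; left; rewrite /signed_basis /= -/(basis i).
  by apply/eq_lattice => j; rewrite !coordE; ring.
Qed.

Lemma neighbor_sum (V : nmodType) (f : lattice d -> V) k :
  \sum_(l \in [set l | lattice_neighbor l k]) f l =
  \sum_(i < d) (f (k + basis i) + f (k - basis i)).
Proof.
have -> : [set l | lattice_neighbor l k] =
    (fun x => k + signed_basis x) @` [set` enum {: 'I_d * bool}].
  apply/seteqP; split=> l /=; first move=> /neighborP[x ->].
    by exists x => //=; rewrite mem_enum.
  by move=> [x _ <-]; apply/neighborP; exists x.
rewrite fsbig_image; last by move=> x y _ _ /addrI/signed_basis_inj.
rewrite -fsbig_seq ?enum_uniq// big_enum /=.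
rewrite -(pair_bigA _ (fun i b => f (k + signed_basis (i, b)))) /=.
by apply: eq_bigr => i _; rewrite big_bool.
Qed.

Definition neighbor_preserving (s : lattice d -> lattice d) :=
  forall k l, lattice_neighbor l k -> lattice_neighbor (s l) (s k).

Lemma neighbor_sum_involution (V : nmodType) s (f : lattice d -> V) k :
    involutive s -> neighbor_preserving s ->
  \sum_(l \in [set l | lattice_neighbor l (s k)]) f l =
  \sum_(l \in [set l | lattice_neighbor l k]) f (s l).
Proof.
move=> sK sP; apply: reindex_fsbig; split=> [l /= /sP//|x y _ _ /(inv_inj sK)//|].
by move=> l /= lk; exists (s l); rewrite ?sK//= -[k]sK; exact: sP.
Qed.

(* Reflection in the hyperplane [x_i = c / 2]. *)
Definition reflect_coord i (c : int) k : lattice d :=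
  k + (c - 2 * k 0 i) *: basis i.

(* Reflection in the hyperplane [x_i + x_j = c], for [i != j]. *)
Definition reflect_diag i j (c : int) k : lattice d :=
  k + (c - k 0 i - k 0 j) *: (basis i + basis j).

Definition flip_signs (e : 'I_d -> bool) k : lattice d :=
  \row_i (if e i then - k 0 i else k 0 i).

Lemma reflect_coordK i c : involutive (reflect_coord i c).
Proof.
move=> k; apply/eq_lattice => j; rewrite /reflect_coord !coordE eqxx /=.
by case: (j == i) => /=; ring.
Qed.

Lemma reflect_diagK i j c : i != j -> involutive (reflect_diag i j c).
Proof.
move=> ij k; apply/eq_lattice => a; rewrite /reflect_diag !coordE !eqxx.
by rewrite (eq_sym j i) (negPf ij) /=; case: (a == i); case: (a == j) => /=; ring.
Qed.

Lemma flip_signsK e : involutive (flip_signs e).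
Proof.
by move=> k; apply/eq_lattice => a; rewrite !mxE; case: (e a); rewrite ?opprK.
Qed.

Lemma neighbor_preserving_affine s :
  (forall k x, exists y, s (k + signed_basis x) = s k + signed_basis y) ->
  neighbor_preserving s.
Proof.
move=> h k l /neighborP[x ->]; apply/neighborP.
by have [y ->] := h k x; exists y.
Qed.

Lemma reflect_coord_neighbor i c : neighbor_preserving (reflect_coord i c).
Proof.
apply: neighbor_preserving_affine => k [a b].
have [->|ai] := eqVneq a i.
  exists (i, ~~ b); apply/eq_lattice => j.
  by case: b; rewrite /reflect_coord /signed_basis /= !coordE eqxx /=;
     case: (j == i) => /=; ring.
exists (a, b); apply/eq_lattice => j.
by case: b; rewrite /reflect_coord /signed_basis /= !coordE (eq_sym i) (negPf ai);
   case: (j == i) => /=; ring.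
Qed.

(** The linear part exchanges $e_i$ with $-e_j$ and $e_j$ with $-e_i$, and fixes the other basis
    vectors. *)
Lemma reflect_diag_neighbor i j c :
  i != j -> neighbor_preserving (reflect_diag i j c).
Proof.
move=> ij; apply: neighbor_preserving_affine => k [a b].
have ji : j != i by rewrite eq_sym.
have [->|ai] := eqVneq a i.
  exists (j, ~~ b); apply/eq_lattice => h.
  by case: b; rewrite /reflect_diag /signed_basis /= !coordE eqxx (negPf ji) /=;
     case: (h == i); case: (h == j) => /=; ring.
have [->|aj] := eqVneq a j.
  exists (i, ~~ b); apply/eq_lattice => h.
  by case: b; rewrite /reflect_diag /signed_basis /= !coordE eqxx (negPf ij) /=;
     case: (h == i); case: (h == j) => /=; ring.
exists (a, b); apply/eq_lattice => h.
by case: b; rewrite /reflect_diag /signed_basis /= !coordE (eq_sym i) (eq_sym j)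
   (negPf ai) (negPf aj) /=; case: (h == i); case: (h == j) => /=; ring.
Qed.

Lemma flip_signs_neighbor e : neighbor_preserving (flip_signs e).
Proof.
apply: neighbor_preserving_affine => k [a b]; exists (a, b (+) e a).
apply/eq_lattice => h.
have [->|ha] := eqVneq h a.
  by case: b; case ea: (e a); rewrite /signed_basis /= !(coordE, mxE) ea !eqxx /=; ring.
by case: b; case ea: (e a); rewrite /signed_basis /= !(coordE, mxE) (negPf ha);
   case: (e h) => /=; ring.
Qed.

End lattice.

(** * Monotonicity and reflection *)

Section neighbor_average.
Variables (R : realType) (d : nat).
Implicit Types (f g : lattice d -> R) (k : lattice d).

Definition nbr_avg f k : R :=
  (2 * d%:R)^-1 * \sum_(i < d) (f (k + basis i) + f (k - basis i)).

Lemma neighbor_add k i : lattice_neighbor (k + basis i) k.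
Proof. by apply/neighborP; exists (i, true). Qed.

Lemma neighbor_sub k i : lattice_neighbor (k - basis i) k.
Proof. by apply/neighborP; exists (i, false). Qed.

Lemma nbr_avgE f k :
  nbr_avg f k = (2 * d%:R)^-1 * \sum_(l \in [set l | lattice_neighbor l k]) f l.
Proof. by rewrite neighbor_sum. Qed.

Lemma nbr_avg_le f g k : (forall l, lattice_neighbor l k -> f l <= g l) ->
  nbr_avg f k <= nbr_avg g k.
Proof.
move=> fg; apply: ler_wpM2l; first by rewrite invr_ge0 mulr_ge0.
by apply: ler_sum => i _; rewrite lerD// fg//;
   [exact: neighbor_add|exact: neighbor_sub].
Qed.

Lemma nbr_avgB f g k : nbr_avg (fun l => f l - g l) k = nbr_avg f k - nbr_avg g k.
Proof.
rewrite -mulrBr; congr (_ * _); rewrite -sumrB.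
by apply: eq_bigr => i _; ring.
Qed.

Lemma nbr_avgZ c f k : nbr_avg (fun l => c * f l) k = c * nbr_avg f k.
Proof.
rewrite /nbr_avg [RHS]mulrCA; congr (_ * _); rewrite mulr_sumr.
by apply: eq_bigr => i _; rewrite mulrDr.
Qed.

Lemma nbr_avg_cst c k : (0 < d)%N -> nbr_avg (cst c) k = c.
Proof.
move=> d0; have dR : d%:R != 0 :> R by rewrite pnatr_eq0 -lt0n.
rewrite /nbr_avg /= sumr_const card_ord -[_ *+ d]mulr_natr; field.
by rewrite dR.
Qed.

Lemma nbr_avg_involution f s k : involutive s -> neighbor_preserving s ->
  nbr_avg f (s k) = nbr_avg (f \o s) k.
Proof. by move=> sK sP; rewrite !nbr_avgE neighbor_sum_involution. Qed.

End neighbor_average.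

(** The recursion without its probability space, split into $x-x^{m+1}$, monotone up to $1/2$, and
    an average of powers, monotone on nonnegative functions. *)
Definition CM_solution (R : realType) (d : nat) (m : R)
    (u : nat -> lattice d -> R) :=
  (forall k, u 0%N k = (k == 0)%:R) /\
  (forall n k, u n.+1 k = u n k - u n k `^ (m + 1) +
     nbr_avg (fun l => u n l `^ (m + 1)) k).

Lemma CM_distributed_solution (R : realType) (d : nat) (m : R)
    (dsp : measure_display) (T : measurableType dsp) (P : probability T R)
    (X : nat -> T -> lattice d) :
  (0 < d)%N -> CM_distributed m P X ->
  CM_solution m (fun n k => lattice_pmf P X k n).
Proof.
move=> d0 [_ p0 pS]; split=> // n k; rewrite pS -nbr_avgE.
by rewrite nbr_avgB (nbr_avg_cst _ _ d0) /=; ring.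
Qed.

Section dynamics.
Variables (R : realType) (d : nat) (m : R) (u : nat -> lattice d -> R).
Hypotheses (d_gt1 : (1 < d)%N) (m_ge1 : 1 <= m) (uP : CM_solution m u).
Implicit Types (k l : lattice d) (n : nat).

Let m0 : 0 <= m + 1. Proof. by move: m_ge1; lra. Qed.

Lemma powR_le x y : 0 <= x -> x <= y -> x `^ (m + 1) <= y `^ (m + 1).
Proof. by move=> x0 xy; apply: ge0_ler_powR; rewrite ?nnegrE// (le_trans x0). Qed.

(** One-step comparison principle. The bound $1/2$ is asked for at [k] only, where $x-x^{m+1}$ is
    evaluated. *)
Lemma step_le (f g : lattice d -> R) k :
    0 <= f k -> f k <= g k -> g k <= 2^-1 ->
    (forall l, lattice_neighbor l k -> 0 <= f l /\ f l <= g l) ->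
  f k - f k `^ (m + 1) + nbr_avg (fun l => f l `^ (m + 1)) k <=
  g k - g k `^ (m + 1) + nbr_avg (fun l => g l `^ (m + 1)) k.
Proof.
move=> f0 fg g2 fgl; apply: lerD.
  by have := powR_sub_le m_ge1 f0 fg g2; lra.
by apply: nbr_avg_le => l /fgl[]; exact: powR_le.
Qed.

(** The initial values 0 and 1 are fixed by the power, so the first step moves all the mass from the
    origin to its neighbors. *)
Lemma solution1E k :
  u 1%N k = (2 * d%:R)^-1 * (`[< lattice_neighbor 0 k >])%:R.
Proof.
have [u0 uS] := uP.
have m1 : m + 1 != 0 by rewrite gt_eqF//; move: m_ge1; lra.
have b_powR (b : bool) : b%:R `^ (m + 1) = b%:R :> R.
  by case: b; rewrite ?powR1 ?powR0.
rewrite uS u0 b_powR subrr add0r nbr_avgE; congr (_ * _).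
under eq_fsbigr do rewrite u0 b_powR.
case: asboolP => [nk|nk].
  rewrite -(@fsbig_widen _ _ _ _ [set 0]) ?fsbig_set1 ?eqxx// => [l ->//|l [] _ /=].
  by move=> /eqP/negPf ->.
by rewrite fsbig1// => l /= lk; case: eqP lk => // ->.
Qed.

(** Constants are stationary, so [step_le] compares with 0 and $1/4$. At time 1 the values are 0 or
    $1/(2d)\le1/4$, as $d\ge2$. *)
Lemma solution_bounds n k : 0 <= u n.+1 k /\ u n.+1 k <= 4^-1.
Proof.
have [u0 uS] := uP; have d0 : (0 < d)%N by apply: ltnW.
elim: n k => [|n IH] k.
  rewrite solution1E; split; first by rewrite mulr_ge0// invr_ge0 mulr_ge0.
  have d2 : 2 <= d%:R :> R by rewrite ler_nat.
  have : (2 * d%:R)^-1 <= 4^-1 :> R by rewrite lef_pV2 ?posrE; lra.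
  by case: asboolP => _ /=; rewrite ?mulr1 ?mulr0//; lra.
split.
  have := @step_le (cst 0) (u n.+1) k; rewrite -uS.
  rewrite /= powR0 ?gt_eqF//; last by move: m_ge1; lra.
  rewrite subr0 add0r (nbr_avg_cst _ _ d0); apply => //.
  - by case: (IH k).
  - by have [_] := IH k; lra.
  - by move=> l _; split=> //; case: (IH l).
have := @step_le (u n.+1) (cst 4^-1) k; rewrite -uS /= (nbr_avg_cst _ _ d0) subrK.
apply; first by case: (IH k).
- by case: (IH k).
- by lra.
- by move=> l _; case: (IH l).
Qed.

Lemma solution_ge0 n k : 0 <= u n k.
Proof.
case: n => [|n]; last by case: (solution_bounds n k).
by have [-> _] := uP; case: eqP.
Qed.

Lemma solution_le1 n k : u n k <= 1.
Proof.
case: n => [|n]; last by have [_] := solution_bounds n k; lra.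
by have [-> _] := uP; case: eqP.
Qed.

Lemma solution_involution s n k : involutive s -> neighbor_preserving s ->
  s 0 = 0 -> u n (s k) = u n k.
Proof.
move=> sK sP s0; have [u0 uS] := uP.
elim: n k => [|n IH] k.
  by rewrite !u0 -{1}s0 (inj_eq (inv_inj sK)).
rewrite !uS IH nbr_avg_involution//; congr (_ + _).
by rewrite /nbr_avg; under eq_bigr do rewrite /= !IH.
Qed.

Lemma solution_flip e n k : u n (flip_signs e k) = u n k.
Proof.
apply: solution_involution; [exact: flip_signsK|exact: flip_signs_neighbor|].
by apply/eq_lattice => i; rewrite !mxE oppr0; case: (e i).
Qed.

(* Aleksandrov reflection. A neighbor of [k] outside of [H] can only be [s k],
   and its negative contribution is absorbed by [powR_sub_le_half]. *)
Lemma solution_reflection s (H : lattice d -> Prop) n k :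
    involutive s -> neighbor_preserving s ->
    (forall k, H k -> H (s k) -> s k = k) ->
    (forall k, lattice_neighbor 0 k -> H k) ->
    (forall k l, H k -> s k <> k -> lattice_neighbor l k -> H l \/ l = s k) ->
  H k -> u n.+1 (s k) <= u n.+1 k.
Proof.
move=> sK sP Hfix H0 Hnbr; have [u0 uS] := uP.
elim: n k => [|n IH] k Hk.
  (* If [s k] is a neighbor of 0, it lies in [H], and then [s k = k]. *)
  rewrite !solution1E ler_wpM2l// ?invr_ge0 ?mulr_ge0// ler_nat.
  case: asboolP => // sk0; have sk : s k = k by apply: Hfix => //; exact: H0.
  by rewrite sk in sk0; case: asboolP.
have [->//|/eqP skN] := eqVneq (s k) k.
rewrite (uS n.+1 (s k)) (uS n.+1 k) nbr_avg_involution//.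
have [fs0 _] := solution_bounds n (s k).
have [_ fk4] := solution_bounds n k.
set f := u n.+1 in IH fs0 fk4 *.
have := powR_sub_le_half m_ge1 fs0 (IH _ Hk) fk4.
have D0 := powR_le fs0 (IH _ Hk).
set D := f k `^ (m + 1) - f (s k) `^ (m + 1).
(* By [powR_sub_le_half], $2D\le f(k)-f(s k)$: one [D] pays for the loss terms, the other for the
   averages. *)
suff : - D <= nbr_avg (fun l => f l `^ (m + 1)) k -
    nbr_avg ((fun l => f l `^ (m + 1)) \o s) k by rewrite /D; lra.
have d0 : (0 < d)%N by apply: ltnW.
rewrite -nbr_avgB -[- D](nbr_avg_cst _ k d0); apply: nbr_avg_le => l lk /=.
have [Hl|->] := Hnbr _ _ Hk skN lk.
  apply: (@le_trans _ _ 0); first by rewrite oppr_le0 subr_ge0.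
  by rewrite subr_ge0; apply: powR_le (IH _ Hl); case: (solution_bounds n (s l)).
by rewrite sK /D opprB.
Qed.

(** A site strictly inside the half-space can leave it only by stepping onto its mirror image, when
    $2k_i+1=c$. [2 <= c] puts the neighbors of 0 inside. *)
Lemma solution_reflect_coord i (c : int) n k : 2 <= c -> 2 * k 0 i <= c ->
  u n.+1 (reflect_coord i c k) <= u n.+1 k.
Proof.
move=> c2; apply: (@solution_reflection _ (fun k => 2 * k 0 i <= c)).
- exact: reflect_coordK.
- exact: reflect_coord_neighbor.
- move=> {}k kc; rewrite /reflect_coord !coordE eqxx => kc'.
  have -> : c - 2 * k 0 i = 0 by lia.
  by rewrite scale0r addr0.
- move=> {}k /neighborP[[a b]] /rowP/(_ i); rewrite !mxE /signed_basis.
  by case: b; rewrite /= !coordE; case: (i == a) => /=; lia.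
- move=> {}k l kc sk /neighborP[[a b] ->].
  have kc' : 2 * k 0 i != c.
    apply/eqP => kE; apply: sk.
    by rewrite /reflect_coord kE subrr scale0r addr0.
  case: b; rewrite /signed_basis /=; last first.
    by left; rewrite !coordE; case: (i == a) => /=; lia.
  have [->|ia] := eqVneq a i; last first.
    by left; rewrite !coordE eq_sym (negPf ia) /=; lia.
  have [kE|kN] := eqVneq (2 * k 0 i + 1) c.
    right; rewrite /reflect_coord; have -> : c - 2 * k 0 i = 1 by lia.
    by rewrite scale1r.
  by left; rewrite !coordE eqxx /=; lia.
Qed.

(** A step changes $x_i+x_j$ by at most 1, so no neighbor of a site strictly inside lies outside. *)
Lemma solution_reflect_diag i j (c : int) n k : i != j -> 1 <= c ->
  k 0 i + k 0 j <= c -> u n.+1 (reflect_diag i j c k) <= u n.+1 k.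
Proof.
move=> ij c1; have ji : j != i by rewrite eq_sym.
apply: (@solution_reflection _ (fun k => k 0 i + k 0 j <= c)).
- exact: reflect_diagK.
- exact: reflect_diag_neighbor.
- move=> {}k kc; rewrite /reflect_diag !coordE !eqxx (negPf ij) (negPf ji) => kc'.
  have -> : c - k 0 i - k 0 j = 0 by move: kc' => /=; lia.
  by rewrite scale0r addr0.
- move=> {}k /neighborP[[a b]] /rowP kE; move: (kE i) (kE j).
  rewrite !mxE /signed_basis.
  have [->|ia] := eqVneq a i.
    by case: b {kE}; rewrite /= !coordE eqxx (negPf ji) /=; lia.
  by case: b {kE}; rewrite /= !coordE (eq_sym i) (negPf ia); case: (j == a) => /=; lia.
- move=> {}k l kc sk /neighborP[[a b] ->]; left.
  have kc' : k 0 i + k 0 j != c.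
    apply/eqP => kE; apply: sk; rewrite /reflect_diag -kE.
    by rewrite (_ : _ - _ - _ = 0) ?scale0r ?addr0//; ring.
  have [->|ia] := eqVneq a i.
    by case: b; rewrite /signed_basis /= !coordE eqxx (negPf ji) /=; lia.
  case: b; rewrite /signed_basis /= !coordE (eq_sym i) (negPf ia);
  by case: (j == a) => /=; lia.
Qed.

(** Reflection in the hyperplane halfway between the two points. For [a = 1] the condition is
    $k_i\ge2$: the solution decreases along a line from level 1 on, but at time 1 it increases from
    the origin to its neighbors. *)
Lemma solution_coord_le i (a : int) n k : 0 <= a -> 2 <= 2 * k 0 i - a ->
  u n.+1 k <= u n.+1 (k - a *: basis i).
Proof.
move=> a0 ka.
have := @solution_reflect_coord i (2 * k 0 i - a) n (k - a *: basis i) ka.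
rewrite /reflect_coord !coordE eqxx.
have -> : 2 * k 0 i - a - 2 * (k 0 i - a * true%:R) = a by rewrite mulr1; ring.
by rewrite subrK; apply; rewrite mulr1; lia.
Qed.

Lemma solution_diag_le i j (a : int) n k : i != j -> 0 <= a ->
    1 <= k 0 i + k 0 j - a ->
  u n.+1 k <= u n.+1 (k - a *: (basis i + basis j)).
Proof.
move=> ij a0 ka; have ji : j != i by rewrite eq_sym.
have := @solution_reflect_diag i j (k 0 i + k 0 j - a) n
  (k - a *: (basis i + basis j)) ij ka.
rewrite /reflect_diag !coordE !eqxx (negPf ij) (negPf ji) /=.
rewrite (_ : k 0 i + k 0 j - a - _ - _ = a); last by ring.
by rewrite subrK; apply; lia.
Qed.

End dynamics.

(** * Mass and decay away from the origin *)

Section extended_sums.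
Variable R : realType.

Lemma esum_finType (F : finType) (f : F -> \bar R) : (forall x, 0 <= f x)%E ->
  (\esum_(x in [set: F]) f x = \sum_x f x)%E.
Proof.
move=> f0; have -> : [set: F] = [set` enum F].
  by apply/seteqP; split=> x //= _; rewrite mem_enum.
rewrite esum_fset//.
by rewrite -fsbig_seq ?enum_uniq// big_enum.
Qed.

Lemma esum_subset (T : choiceType) (A B : set T) (f : T -> \bar R) :
    A `<=` B -> (forall x, 0 <= f x)%E ->
  (\esum_(x in A) f x <= \esum_(x in B) f x)%E.
Proof.
move=> AB f0; rewrite [leLHS]esum_mkcond [leRHS]esum_mkcond; apply: le_esum => x _.
case: ifPn => [/set_mem/AB/mem_set ->//|_].
by case: ifP.
Qed.

(** [g] need not be injective: choosing one preimage [h y] for each [y] turns the left side into a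
    sum over a subset of [F]. *)
Lemma esum_le_cover (F : finType) (T : choiceType) (g : F -> T) (S : set T)
    (f : T -> \bar R) :
    (forall y, S y -> exists x, g x = y) -> (forall y, 0 <= f y)%E ->
  (\esum_(y in S) f y <= \sum_x f (g x))%E.
Proof.
move=> gS f0.
have [x0 _|noF] := pickP (@predT F); last first.
  rewrite esum1 ?sume_ge0// => y /gS[x _].
  by have := noF x.
pose h y := xget x0 [set x | g x = y].
have hK y : S y -> g (h y) = y.
  by move=> /gS[x gx]; rewrite /h; case: xgetP => [z _ //|/(_ x)/(_ gx)].
have hS : set_inj S h by move=> y z Sy Sz /(congr1 g); rewrite !hK// -in_setE.
rewrite -esum_finType; last by move=> x; exact: f0.
apply: le_trans (@esum_subset _ (h @` S) _ _ _ _) => //.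
rewrite esum_image//; apply: le_esum => y Sy; by rewrite hK.
Qed.

Lemma esum_translate d (v : lattice d) (f g : lattice d -> R) :
  (\esum_(k in [set: lattice d]) (f (k + v) * g k)%:E =
   \esum_(k in [set: lattice d]) (f k * g (k - v))%:E)%E.
Proof.
rewrite (reindex_esum [set: lattice d] [set: lattice d] (fun k => k - v)) /=.
  by apply: eq_esum => k _; rewrite subrK.
split=> [//|x y _ _ /addIr//|k _].
by exists (k + v); rewrite ?addrK.
Qed.

(** Self-adjointness of the average: translating one factor by $e_i$ amounts to translating the
    other by $-e_i$. Nonnegativity settles summability. *)
Lemma esum_nbr_avg d (f g : lattice d -> R) :
    (forall k, 0 <= f k) -> (forall k, 0 <= g k) ->
  (\esum_(k in [set: lattice d]) (nbr_avg f k * g k)%:E =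
   \esum_(k in [set: lattice d]) (f k * nbr_avg g k)%:E)%E.
Proof.
move=> f0 g0; set c := (2 * d%:R)^-1 : R.
have c0 : 0 <= c by rewrite invr_ge0 mulr_ge0.
have cf0 k : 0 <= c * f k by rewrite mulr_ge0.
transitivity (\esum_(k in [set: lattice d]) (\sum_(i < d)
   ((c * f (k + basis i) * g k)%:E + (c * f (k - basis i) * g k)%:E)))%E.
  apply: eq_esum => k _; under eq_bigr do rewrite -EFinD.
  rewrite sumEFin; congr (_%:E); rewrite /nbr_avg -/c -mulrA mulr_suml mulr_sumr.
  by apply: eq_bigr => i _; ring.
transitivity (\esum_(k in [set: lattice d]) (\sum_(i < d)
   ((c * f k * g (k + basis i))%:E + (c * f k * g (k - basis i))%:E)))%E; last first.
  apply: eq_esum => k _; under eq_bigr do rewrite -EFinD.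
  rewrite sumEFin; congr (_%:E); rewrite /nbr_avg -/c mulrCA !mulr_sumr.
  by apply: eq_bigr => i _; ring.
rewrite !esum_sum; try by move=> *; rewrite adde_ge0// lee_fin mulr_ge0.
apply: eq_bigr => i _.
rewrite !esumD; try by move=> *; rewrite lee_fin mulr_ge0.
rewrite addeC (esum_translate _ (fun k => c * f k)).
by rewrite (esum_translate _ (fun k => c * f k)) opprK.
Qed.

End extended_sums.

(** * Moments, conservation of mass and decay in space *)

Section moments.
Variables (R : realType) (d : nat) (m : R) (u : nat -> lattice d -> R).
Hypotheses (d_gt1 : (1 < d)%N) (m_ge1 : 1 <= m) (uP : CM_solution m u).
Implicit Types (k l : lattice d) (n : nat) (f : lattice d -> R).

Let d_gt0 : (0 < d)%N. Proof. exact: ltnW. Qed.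

Lemma moment0 f : (forall k, 0 <= f k) ->
  (\esum_(k in [set: lattice d]) (u 0%N k * f k)%:E = (f 0)%:E)%E.
Proof.
move=> f0; rewrite -[RHS](@esum_set1 _ _ 0 (fun k => (f k)%:E)) ?lee_fin//.
rewrite [RHS]esum_mkcond; apply: eq_esum => k _; have [-> _] := uP.
have [->|/eqP k0] := eqVneq k 0; first by rewrite mem_set// mul1r.
by rewrite memNset// mul0r.
Qed.

Lemma powR_solution_le n k : u n k `^ (m + 1) <= u n k.
Proof.
have u0 := solution_ge0 d_gt1 m_ge1 uP n k.
have u1 := solution_le1 d_gt1 m_ge1 uP n k.
have [->|uN] := eqVneq (u n k) 0.
  by rewrite powR0// gt_eqF//; move: m_ge1; lra.
by rewrite ge1r_powR ?u1 ?andbT ?lt_neqAle 1?eq_sym ?uN//; move: m_ge1; lra.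
Qed.

(** Summation by parts: the discrete Laplacian passes from $u^{m+1}$ to [f]. Since $u^{m+1}\le u$,
    the sums split into nonnegative terms. *)
Lemma momentS f n : (forall k, 0 <= f k) ->
  (\esum_(k in [set: lattice d]) (u n.+1 k * f k)%:E =
   \esum_(k in [set: lattice d])
     (u n k * f k + u n k `^ (m + 1) * (nbr_avg f k - f k))%:E)%E.
Proof.
move=> f0; have [_ uS] := uP.
have avg0 g k : (forall k, 0 <= g k) -> 0 <= nbr_avg g k :> R.
  move=> g0; rewrite mulr_ge0 ?invr_ge0 ?mulr_ge0// sumr_ge0// => i _.
  by rewrite addr_ge0.
transitivity (\esum_(k in [set: lattice d])
   (((u n k - u n k `^ (m + 1)) * f k)%:E +
    (nbr_avg (fun l => u n l `^ (m + 1)) k * f k)%:E))%E.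
  by apply: eq_esum => k _; rewrite -EFinD uS mulrDl.
have h0 k : (0 <= ((u n k - u n k `^ (m + 1)) * f k)%:E)%E.
  by rewrite lee_fin mulr_ge0// subr_ge0 powR_solution_le.
rewrite esumD//; last first.
  by move=> k _; rewrite lee_fin mulr_ge0// avg0// => l; exact: powR_ge0.
rewrite esum_nbr_avg//; last by move=> l; exact: powR_ge0.
rewrite -esumD//; last by move=> k _; rewrite lee_fin mulr_ge0 ?powR_ge0// avg0.
by apply: eq_esum => k _; rewrite -EFinD; congr (_%:E); ring.
Qed.

Lemma solution_mass n : (\esum_(k in [set: lattice d]) (u n k)%:E = 1)%E.
Proof.
have mulr1E k j : (u j k)%:E = (u j k * cst 1 k)%:E by rewrite mulr1.
elim: n => [|n IH].
  by under eq_esum do rewrite mulr1E; rewrite moment0.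
under eq_esum do rewrite mulr1E; rewrite momentS// -IH.
by apply: eq_esum => k _; rewrite nbr_avg_cst// subrr mulr0 addr0 mulr1.
Qed.

Lemma solution_sum_le1 (F : finType) (x : F -> lattice d) n :
  injective x -> \sum_a u n (x a) <= 1.
Proof.
move=> xI; rewrite -lee_fin -(solution_mass n) -sumEFin.
have u0 k : (0 <= (u n k)%:E)%E by rewrite lee_fin (solution_ge0 d_gt1 m_ge1 uP).
rewrite -(@esum_finType _ _ (fun a => (u n (x a))%:E))//.
rewrite -(esum_image [set: F] x (fun k => (u n k)%:E)); last by move=> a b _ _ /xI.
exact: esum_subset.
Qed.

(** Each diagonal move lowers coordinate $j$ by $a_j$ at the cost of $a_j$ in coordinate $i$. As
    $k_j\ge0$ and $k_i$ exceeds the total cost, every hyperplane used is admissible. *)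
Lemma solution_diag_iter_le (i : 'I_d) (a : 'I_d -> nat) (s : seq 'I_d) n k :
    uniq s -> i \notin s -> (forall j, j \in s -> 0 <= k 0 j) ->
    (\sum_(j <- s) a j)%N%:Z + 1 <= k 0 i ->
  u n.+1 k <= u n.+1 (k - \sum_(j <- s) (a j)%:Z *: (basis i + basis j)).
Proof.
elim: s k => [|j s IH] k /=; first by rewrite !big_nil subr0.
move=> /andP[js us]; rewrite inE negb_or => /andP[ij is_] k0.
rewrite !big_cons => ki.
have kj : 0 <= k 0 j by apply: k0; rewrite mem_head.
have := @solution_diag_le _ _ _ _ d_gt1 m_ge1 uP i j (a j)%:Z n k ij.
move=> h; apply: le_trans (h _ _) _; [by []|lia|].
rewrite opprD addrA; apply: IH => //.
  move=> l ls; rewrite !coordE.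
  have -> : (l == i) = false by apply/negP => /eqP lE; rewrite -lE ls in is_.
  have -> : (l == j) = false by apply/negP => /eqP lE; rewrite -lE ls in js.
  by rewrite /= addr0 mulr0 subr0 k0// inE ls orbT.
by rewrite !coordE eqxx (negPf ij) /=; lia.
Qed.

(* Moving [k] towards the origin along reflections can only increase the
   solution, so it is at least [u k] on a discrete parallelepiped with about
   [N^d / d^d] points, whose total mass is at most 1. *)
Lemma solution_far_decay (i : 'I_d) n k :
  u n.+1 k * (absz (k 0 i))%:R ^+ d <= d%:R ^+ d.
Proof.
set N := absz (k 0 i).
have [N0|N0] := posnP N; first by rewrite N0 expr0n eqn0Ngt d_gt0 mulr0 exprn_ge0.
have u0 l : 0 <= u n.+1 l by exact: (solution_ge0 d_gt1 m_ge1 uP).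
pose k' := flip_signs (fun j => k 0 j < 0) k.
have k'0 j : 0 <= k' 0 j by rewrite mxE; case: ifP; lia.
have k'i : k' 0 i = N by rewrite mxE; case: ifP; lia.
rewrite -(solution_flip uP (fun j => k 0 j < 0)) -/k'.
(* [d] displacements of size at most [A] cost at most [N - 1] in coordinate [i], which stays
   positive. *)
pose A := (N.-1 %/ d)%N.
pose s := [seq j <- enum 'I_d | j != i].
pose x (a : {ffun 'I_d -> 'I_A.+1}) : lattice d :=
  k' - \sum_(j <- s) (a j)%:Z *: (basis i + basis j) - (a i)%:Z *: basis i.
have s_i a : (\sum_(j <- s) (a j)%:Z *: (basis i + basis j) : lattice d) 0 i =
    (\sum_(j <- s) a j)%N%:Z.
  rewrite summxE (big_morph Posz PoszD (erefl _)); apply: eq_big_seq => j.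
  rewrite mem_filter => /andP[ji _].
  by rewrite !coordE eqxx (eq_sym i) (negPf ji) /= addr0 mulr1.
have a_sum (a : {ffun 'I_d -> 'I_A.+1}) : (\sum_(j <- s) a j + a i <= N.-1)%N.
  have -> : (\sum_(j <- s) a j + a i = \sum_j a j)%N.
    by rewrite (bigD1 i)//= addnC big_filter big_enum_cond.
  apply: (@leq_trans (\sum_(j < d) A)).
    by apply: leq_sum => j _; rewrite -ltnS.
  by rewrite sum_nat_const card_ord mulnC leq_divM.
have ux a : u n.+1 k' <= u n.+1 (x a).
  have := a_sum a => sa.
  have si : i \notin s by rewrite mem_filter eqxx.
  have := @solution_diag_iter_le i (fun j => a j) s n k'.
  rewrite filter_uniq ?enum_uniq// => /(_ erefl si (fun j _ => k'0 j)).
  rewrite k'i /= => h; apply: le_trans (h _) _.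
    by move: sa; move: (\sum_(j <- s) a j)%N => S; lia.
  apply: (solution_coord_le d_gt1 m_ge1 uP) => //; rewrite coordD coordN s_i k'i.
  by move: sa; move: (\sum_(j <- s) a j)%N => S; lia.
(* The coordinates $j\ne i$ reveal $a_j$; given these, coordinate $i$ reveals $a_i$. *)
have xI : injective x.
  move=> a b /rowP xab; apply/ffunP.
  have xj (c : {ffun 'I_d -> 'I_A.+1}) j : j != i -> x c 0 j = k' 0 j - (c j)%:Z.
    move=> ji; rewrite !coordE summxE (negPf ji) mulr0 subr0; congr (_ - _).
    have js : j \in s by rewrite mem_filter ji mem_enum.
    have us : uniq s by rewrite filter_uniq// enum_uniq.
    rewrite (bigD1_seq j js us) /=.
    rewrite !coordE eqxx (negPf ji) add0r mulr1 big1 ?addr0// => l lj.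
    by rewrite !coordE (negPf ji) eq_sym (negPf lj) addr0 mulr0.
  have abj j : j != i -> a j = b j.
    by move=> ji; have := xab j; rewrite !xj// => h; apply/val_inj => /=; lia.
  move=> j; have [->|/abj//] := eqVneq j i.
  have := xab i; rewrite !coordE !s_i eqxx.
  have -> : (\sum_(j <- s) a j = \sum_(j <- s) b j)%N.
    by apply: eq_big_seq => l; rewrite mem_filter => /andP[/abj ->].
  by move=> h; apply/val_inj => /=; lia.
have h1 : u n.+1 k' * A.+1%:R ^+ d <= 1.
  apply: le_trans (solution_sum_le1 n.+1 xI).
  apply: (@le_trans _ _ (\sum_(a : {ffun 'I_d -> 'I_A.+1}) u n.+1 k')).
    by rewrite sumr_const card_ffun !card_ord -natrX mulr_natr.
  by apply: ler_sum.
have h2 : N%:R ^+ d <= d%:R ^+ d * A.+1%:R ^+ d :> R.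
  rewrite -exprMn -natrM; apply: lerXn2r; rewrite ?nnegrE// ler_nat.
  by have := ltn_ceil N.-1 d_gt0; rewrite -/A; lia.
apply: le_trans (ler_wpM2l (u0 _) h2) _.
by rewrite mulrCA -[leRHS]mulr1; apply: ler_wpM2l; rewrite ?exprn_ge0.
Qed.

End moments.

(** * The barrier *)

Section square_norm.
Variables (R : realType) (d : nat).
Implicit Types (k l : lattice d).

Definition sqnorm k : R := \sum_(i < d) (k 0 i)%:~R ^+ 2.

Lemma sqnorm_ge0 k : 0 <= sqnorm k.
Proof. by apply: sumr_ge0 => i _; exact: sqr_ge0. Qed.

Lemma sqnorm_add k (a : int) i :
  sqnorm (k + a *: basis i) = sqnorm k + 2 * a%:~R * (k 0 i)%:~R + a%:~R ^+ 2.
Proof.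
rewrite /sqnorm (bigD1 i)//= [in RHS](bigD1 i)//= !coordE eqxx mulr1.
rewrite (eq_bigr (fun j => (k 0 j)%:~R ^+ 2)); last first.
  by move=> j /negPf ji; rewrite !coordE ji mulr0 addr0.
by rewrite intrD; ring.
Qed.

Lemma sqnorm_addb k i : sqnorm (k + basis i) = sqnorm k + 2 * (k 0 i)%:~R + 1.
Proof. by rewrite -{1}[basis i]scale1r sqnorm_add; ring. Qed.

Lemma sqnorm_subb k i : sqnorm (k - basis i) = sqnorm k - 2 * (k 0 i)%:~R + 1.
Proof. by rewrite -{1}[basis i]scale1r -scaleNr sqnorm_add; ring. Qed.

Lemma nbr_avg_sqnorm k : (0 < d)%N -> nbr_avg sqnorm k = sqnorm k + 1.
Proof.
move=> d0; rewrite -(nbr_avg_cst (sqnorm k + 1) k d0); congr (_ * _).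
by apply: eq_bigr => i _; rewrite sqnorm_addb sqnorm_subb /=; ring.
Qed.

Lemma sqr_coord_le_sqnorm k i : (k 0 i)%:~R ^+ 2 <= sqnorm k.
Proof.
by rewrite /sqnorm (bigD1 i)//= lerDl; apply: sumr_ge0 => j _; exact: sqr_ge0.
Qed.

(** By $2|k_i|\le k_i^2+1$. For $\rho\ge1$, neighbors of points in the ball of radius $\rho$ stay in
    the ball of radius $2\rho$. *)
Lemma sqnorm_neighbor k l : lattice_neighbor l k ->
  sqnorm l <= 2 * sqnorm k + 2.
Proof.
move=> /neighborP[[i b] ->]; have := sqr_coord_le_sqnorm k i.
have := sqr_ge0 ((k 0 i)%:~R + 1 : R); have := sqr_ge0 ((k 0 i)%:~R - 1 : R).
by case: b; rewrite /signed_basis /= ?sqnorm_addb ?sqnorm_subb !expr2; lra.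
Qed.

(** If all coordinates were below $\rho/d$ in absolute value, the squared norm would be below
    $\rho^2/d$. *)
Lemma sqnorm_large_coord k (rho : R) : 0 < rho -> rho ^+ 2 <= sqnorm k ->
  exists i, rho <= d%:R * (absz (k 0 i))%:R.
Proof.
move=> rho0 rhok; apply: contrapT => /forallNP small.
have [d0|d0] := posnP d.
  have : sqnorm k <= 0 by rewrite /sqnorm big1// => i _; have := ltn_ord i; rewrite {2}d0.
  by move/(le_trans rhok); rewrite leNgt exprn_gt0.
have dR : 1 <= d%:R :> R by rewrite ler1n.
have ki i : d%:R ^+ 2 * (k 0 i)%:~R ^+ 2 < rho ^+ 2 :> R.
  rewrite -[_%:~R ^+ 2]real_normK ?num_real// -exprMn.
  move/negP: (small i); rewrite -ltNge natr_absz intr_norm => h.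
  have p0 : 0 <= d%:R * `|(k 0 i)%:~R| :> R by rewrite mulr_ge0.
  by rewrite !expr2 ltr_pM.
have : d%:R ^+ 2 * sqnorm k < d%:R * rho ^+ 2.
  rewrite /sqnorm mulr_sumr -[d in d%:R * rho ^+ 2]card_ord mulr_natl -sumr_const.
  by apply: ltr_sum => //; apply/hasP; exists (Ordinal d0); rewrite ?mem_index_enum.
have : d%:R * rho ^+ 2 <= d%:R ^+ 2 * rho ^+ 2.
  by rewrite ler_wpM2r ?sqr_ge0// expr2 ler_peMl// ler0n.
have : d%:R ^+ 2 * rho ^+ 2 <= d%:R ^+ 2 * sqnorm k by rewrite ler_wpM2l ?sqr_ge0.
lra.
Qed.

End square_norm.

Section barrier.
Variables (R : realType) (d : nat) (m : R) (u : nat -> lattice d -> R).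
Hypotheses (d_gt1 : (1 < d)%N) (m_ge1 : 1 <= m) (uP : CM_solution m u).
Variable rho : R.
Hypothesis rho_ge1 : 1 <= rho.
Implicit Types (k l : lattice d) (n j : nat).

(** Keeps $1-\kappa|k|^2$ in $[1/2,1]$ on the ball of radius $2\rho$. *)
Let kappa : R := (8 * rho ^+ 2)^-1.

(** The offset $2^m$ gives the initial value $1/2$: on the ball of radius $2\rho$ the barrier starts
    above $1/4$ and stays where steps are monotone. *)
Definition amplitude n : R := (2 `^ m + m * kappa * n%:R) `^ (- m^-1).

(* A discrete version of the separable solution [t^(-1/m) f(x)] of the porous
   medium equation. *)
Definition barrier n k : R :=
  amplitude n * (1 - kappa * sqnorm R k) `^ (m + 1)^-1.

Let m0 : 0 < m. Proof. by move: m_ge1; lra. Qed.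
Let d_gt0 : (0 < d)%N. Proof. exact: ltnW. Qed.

Let rho2_ge1 : 1 <= rho ^+ 2. Proof. by rewrite exprn_ege1. Qed.

Let kappa_gt0 : 0 < kappa.
Proof. by rewrite invr_gt0; move: rho2_ge1; lra. Qed.

Let kappa_rho : kappa * rho ^+ 2 = 8^-1.
Proof. by rewrite /kappa; field; rewrite gt_eqF//; move: rho_ge1; lra. Qed.

Let base_gt0 n : 0 < 2 `^ m + m * kappa * n%:R.
Proof. by rewrite ltr_pwDl ?powR_gt0// !mulr_ge0 ?ler0n ?ltW. Qed.

Let amplitude_gt0 n : 0 < amplitude n. Proof. exact: powR_gt0. Qed.

Let amplitude_anti j n : (j <= n)%N -> amplitude n <= amplitude j.
Proof.
move=> jn; apply: powRN_anti; rewrite ?invr_ge0 ?(ltW m0)// lerD2l ler_wpM2l ?ler_nat//.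
by rewrite mulr_ge0// ltW.
Qed.

Let amplitude0 : amplitude 0 = 2^-1.
Proof.
rewrite /amplitude mulr0 addr0 -powRrM mulrN divff ?powR_inv1 ?ler0n//.
by rewrite gt_eqF.
Qed.

Let amplitudeS n : amplitude n - kappa * amplitude n `^ (m + 1) <= amplitude n.+1.
Proof.
have := powRN_step m0 (base_gt0 n) (ltW kappa_gt0).
by rewrite /amplitude -[in n.+1%:R]natr1; rewrite mulrDr mulr1 addrA.
Qed.

Let profile k : R := (1 - kappa * sqnorm R k) `^ (m + 1)^-1.

Let profile_base k : sqnorm R k <= 4 * rho ^+ 2 ->
  2^-1 <= 1 - kappa * sqnorm R k /\ 1 - kappa * sqnorm R k <= 1.
Proof.
move=> k4; have := ler_wpM2l (ltW kappa_gt0) k4.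
have := mulr_ge0 (ltW kappa_gt0) (sqnorm_ge0 R k).
by have := kappa_rho; lra.
Qed.

Let profile_bounds k : sqnorm R k <= 4 * rho ^+ 2 ->
  2^-1 <= profile k /\ profile k <= 1.
Proof.
move=> /profile_base[b2 b1]; split.
  apply: (le_trans b2); apply: ger1_powR.
    by apply/andP; split=> //; apply: lt_le_trans b2; lra.
  by rewrite invf_le1 ?addr_gt0 ?m0//; move: m0; lra.
have b0 : 0 <= 1 - kappa * sqnorm R k by lra.
have mi : 0 <= (m + 1)^-1 by rewrite invr_ge0; move: m0; lra.
apply: (@le_trans _ _ (1 `^ (m + 1)^-1)); last by rewrite powR1.
by apply: ge0_ler_powR; rewrite ?nnegrE.
Qed.

(** The reason for the exponent of the profile: this power is quadratic in [k], with an explicit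
    neighbor average. *)
Let barrier_powR n k : sqnorm R k <= 4 * rho ^+ 2 ->
  barrier n k `^ (m + 1) = amplitude n `^ (m + 1) * (1 - kappa * sqnorm R k).
Proof.
move=> /profile_base[b2 _].
have b0 : 0 <= 1 - kappa * sqnorm R k by lra.
rewrite powRM ?powR_ge0 ?(ltW (amplitude_gt0 n))// -powRrM mulVf ?powRr1//.
by rewrite gt_eqF//; move: m0; lra.
Qed.

(** Induction on time. Between radii $\rho$ and $2\rho$ the bound [b] is below the barrier; inside
    radius $\rho$ comparison applies, all neighbors being within $2\rho$. The solution runs one step
    ahead, so as to start below $1/4$. *)
Lemma solution_le_barrier b n :
    (forall j k, rho ^+ 2 <= sqnorm R k -> u j.+1 k <= b) ->
    b <= amplitude n / 2 ->
  forall j k, (j <= n)%N -> sqnorm R k <= 4 * rho ^+ 2 -> u j.+1 k <= barrier j k.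
Proof.
move=> ub bn; elim=> [|j IH] k jn k4.
  have [_ u4] := solution_bounds d_gt1 m_ge1 uP 0 k.
  apply: le_trans u4 _; rewrite /barrier amplitude0.
  by have [] := profile_bounds k4; rewrite /profile; lra.
have [p2 p1] := profile_bounds k4.
have [rk|kr] := leP (rho ^+ 2) (sqnorm R k).
  apply: le_trans (ub j.+1 _ rk) _; apply: le_trans bn _.
  by apply: ler_pM; rewrite ?invr_ge0 ?ler0n ?(ltW (amplitude_gt0 n)) ?amplitude_anti.
have l4 l : lattice_neighbor l k -> sqnorm R l <= 4 * rho ^+ 2.
  by move=> /(sqnorm_neighbor R); move: rho2_ge1; lra.
have jn' : (j <= n)%N := ltnW jn.
have aj2 : amplitude j <= 2^-1 by rewrite -amplitude0 amplitude_anti.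
have [_ uS] := uP; rewrite uS.
apply: le_trans (step_le m_ge1 (g := barrier j) _ _ _ _) _.
- by case: (solution_bounds d_gt1 m_ge1 uP j k).
- exact: IH.
- rewrite -[leRHS]mulr1; apply: ler_pM => //; first exact: ltW (amplitude_gt0 j).
  exact: powR_ge0.
- move=> l lk; split; last by apply: IH => //; exact: l4.
  by case: (solution_bounds d_gt1 m_ge1 uP j l).
(* Averaging adds 1 to $|k|^2$, so a step lowers the barrier by $\kappa A^{m+1}$, where $A$ is the
   amplitude; as the profile is at most 1, [amplitudeS] times the profile suffices. *)
have : nbr_avg (fun l => barrier j l `^ (m + 1)) k <=
    amplitude j `^ (m + 1) * (1 - kappa * (sqnorm R k + 1)).
  have <- : nbr_avg (fun l => amplitude j `^ (m + 1) *
      (cst 1 l - kappa * sqnorm R l)) k =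
      amplitude j `^ (m + 1) * (1 - kappa * (sqnorm R k + 1)).
    by rewrite nbr_avgZ nbr_avgB nbr_avgZ nbr_avg_cst// nbr_avg_sqnorm.
  by apply: nbr_avg_le => l /l4 kl; rewrite barrier_powR.
rewrite barrier_powR// {2}/barrier -/(profile k).
have := ler_wpM2r (le_trans (_ : 0 <= 2^-1) p2) (amplitudeS j).
rewrite invr_ge0 ler0n /barrier -/(profile k) => /(_ erefl).
have a0 : 0 <= kappa * amplitude j `^ (m + 1).
  by rewrite mulr_ge0 ?powR_ge0// ltW.
have := ler_wpM2l a0 p1.
lra.
Qed.

Lemma solution_le_amplitude b n :
    (forall j k, rho ^+ 2 <= sqnorm R k -> u j.+1 k <= b) ->
    b <= amplitude n / 2 ->
  forall k, u n.+1 k <= amplitude n.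
Proof.
move=> ub bn k; have a0 := amplitude_gt0 n.
have [rk|kr] := leP (rho ^+ 2) (sqnorm R k).
  by apply: le_trans (ub n _ rk) _; lra.
have k4 : sqnorm R k <= 4 * rho ^+ 2 by move: rho2_ge1; lra.
apply: le_trans (solution_le_barrier ub bn (leqnn n) k4) _.
have [_ p1] := profile_bounds k4.
by rewrite -[leRHS]mulr1; apply: ler_wpM2l => //; exact: ltW.
Qed.

End barrier.

Lemma CM_betaE (R : realType) (d : nat) (m : R) : 1 <= m ->
  CM_beta d m * (d%:R * m + 2) = 1.
Proof.
move=> m1; rewrite /CM_beta mulVf// gt_eqF// ltr_wpDl//.
by rewrite mulr_ge0//; lra.
Qed.

Lemma CM_beta_gt0 (R : realType) (d : nat) (m : R) : 1 <= m -> 0 < CM_beta d m.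
Proof.
move=> m1; rewrite /CM_beta invr_gt0 ltr_wpDl//.
by rewrite mulr_ge0//; lra.
Qed.

(** * Decay of the supremum in time *)

Section sup_bound.
Variables (R : realType) (d : nat) (m : R).
Hypotheses (d_gt1 : (1 < d)%N) (m_ge1 : 1 <= m).
Local Notation beta := (CM_beta d m).

(** With $q=n^\beta$ and $\rho=Kq$, the bound outside radius $\rho$ and the amplitude are both of
    order $q^{-d}$; a large [K] puts the former below half the latter. *)
Lemma solution_sup_bound : exists2 C : R, 0 < C &
  forall u, CM_solution m u -> forall n (k : lattice d), (0 < n)%N ->
    u n k <= C * n%:R `^ (- (d%:R * beta)).
Proof.
have m1 := m_ge1; have m0 : 0 < m by lra.
have d0 : 0 < d%:R :> R by rewrite ltr0n ltnW.
have d1 : 1 <= d%:R :> R by rewrite ler1n ltnW.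
(* $d^2$ offsets the factors [d] lost in [sqnorm_large_coord] and in [solution_far_decay]; $8m$
   yields $L=(8m)^d/2\ge4$ below. *)
pose K : R := 8 * d%:R ^+ 2 * m.
have d2 : 1 <= d%:R ^+ 2 :> R by rewrite exprn_ege1.
have dm : m <= d%:R ^+ 2 * m by rewrite ler_peMl ?(ltW m0).
have K8 : 8 <= K by rewrite /K -mulrA; lra.
have Km : m <= K ^+ 2.
  have mK : m <= K by rewrite /K -mulrA; lra.
  have : K * 1 <= K * K by rewrite ler_wpM2l; lra.
  by rewrite expr2; lra.
have K0 : 0 < K by lra.
pose c := m / (8 * K ^+ 2).
have c0 : 0 < c by rewrite divr_gt0// mulr_gt0// exprn_gt0.
exists (c `^ (- m^-1)); first exact: powR_gt0.
move=> u uP [//|n] k _.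
pose q : R := n.+1%:R `^ beta.
have b0 := CM_beta_gt0 d m_ge1.
have q1 : 1 <= q.
  by rewrite -(powRr0 (n.+1%:R : R)); apply: ler_powR; rewrite ?ler1n ?(ltW b0).
have q0 : 0 < q by lra.
have qd0 : 0 < q ^+ d by rewrite exprn_gt0.
pose rho := K * q.
have rho1 : 1 <= rho by rewrite /rho; nra.
have rho0 : 0 < rho by lra.
pose b := (d%:R ^+ 2 / rho) ^+ d.
have ub j l : rho ^+ 2 <= sqnorm R l -> u j.+1 l <= b.
  move=> /(sqnorm_large_coord rho0)[i rhoi].
  rewrite /b expr_div_n ler_pdivlMr ?exprn_gt0//.
  have ul0 := solution_ge0 d_gt1 m_ge1 uP j.+1 l.
  have : rho ^+ d <= (d%:R * (absz (l 0 i))%:R) ^+ d.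
    by apply: lerXn2r; rewrite ?nnegrE ?(ltW rho0)// mulr_ge0.
  move/(ler_wpM2l ul0)/le_trans; apply.
  rewrite exprMn mulrCA -exprM mul2n -addnn exprD.
  by apply: ler_wpM2l; [exact: exprn_ge0|exact: (solution_far_decay d_gt1 m_ge1 uP)].
have powRmK x : 0 <= x -> (x `^ m) `^ (- m^-1) = x^-1.
  by move=> x0; rewrite -powRrM mulrN divff ?gt_eqF// powR_inv1.
(* The scaling relation $\beta(dm+2)=1$. *)
have qE : (q ^+ d) `^ m * q ^+ 2 = n.+1%:R.
  rewrite -!powR_mulrn ?(ltW q0)// -[X in X * _]powRrM -powRD ?(gt_eqF q0) ?implybT//.
  by rewrite -powRrM CM_betaE// powRr1.
have kn : m * (8 * rho ^+ 2)^-1 * n.+1%:R = c * (q ^+ d) `^ m.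
  by rewrite -qE /c /rho; field; rewrite !gt_eqF.
pose D := (q ^+ d) `^ m; rewrite -/D in qE kn.
have D1 : 1 <= D.
  by rewrite -(powRr0 (q ^+ d)); apply: ler_powR; rewrite ?exprn_ege1 ?(ltW m0).
have Dp : 0 < D by lra.
pose L : R := K ^+ d / (2 * (d%:R ^+ 2) ^+ d).
have L4 : 4 <= L.
  have -> : L = (8 * m) ^+ d / 2.
    rewrite /L /K -[8 * _ * m]mulrA [_ * m]mulrC mulrA exprMn; field.
    by rewrite gt_eqF// exprn_gt0// exprn_gt0.
  have : (8 * m) ^+ 1 <= (8 * m) ^+ d by apply: ler_weXn2l; [lra|exact: ltnW].
  by rewrite expr1; lra.
have L0 : 0 < L by lra.
have bE : b = (L * q ^+ d)^-1 / 2.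
  have : (d%:R ^+ 2) ^+ d != 0 :> R by rewrite gt_eqF ?exprn_gt0.
  have : K ^+ d != 0 by rewrite gt_eqF ?exprn_gt0.
  have : q ^+ d != 0 by rewrite gt_eqF.
  rewrite /b /L /rho expr_div_n (exprMn _ K q).
  move: (q ^+ d) (K ^+ d) ((d%:R ^+ 2) ^+ d) => x y z x0 y0 z0; field.
  by rewrite x0 y0 z0.
have two_m : 2 <= 2 `^ m :> R.
  by have := @bernoulli_powR R m 2 m_ge1 (ler0n _ 2); lra.
(* Says that the amplitude at [n] is at least $1/(Lq^d)=2b$. *)
have base_le : 2 `^ m + m * (8 * rho ^+ 2)^-1 * n%:R <= (L * q ^+ d) `^ m.
  rewrite powRM ?(ltW L0) ?(ltW qd0)// -/D.
  have : m * (8 * rho ^+ 2)^-1 * n%:R <= c * D.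
    rewrite -kn ler_wpM2l ?ler_nat// mulr_ge0 ?invr_ge0 ?(ltW m0)//.
    by rewrite mulr_ge0 ?sqr_ge0.
  have : c <= 1 by rewrite /c ler_pdivrMr ?mulr_gt0 ?exprn_gt0//; lra.
  have : 2 `^ m * 2 `^ m <= L `^ m.
    by rewrite -powRM//; apply: ge0_ler_powR; rewrite ?nnegrE; lra.
  have D0 : 0 <= D by lra.
  have T0 : 0 <= 2 `^ m :> R by lra.
  move=> LT /(ler_wpM2r D0) c1.
  have /(ler_wpM2r D0) : 2 `^ m + 1 <= L `^ m.
    by have := ler_wpM2l T0 two_m; lra.
  have := ler_wpM2l T0 D1.
  lra.
(* The offset $2^m\ge m$ makes up for the step between [n] and [n.+1]. *)
have base_ge : c * D <= 2 `^ m + m * (8 * rho ^+ 2)^-1 * n%:R.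
  have kappa1 : (8 * rho ^+ 2)^-1 <= 1.
    by rewrite invf_le1 ?mulr_gt0 ?exprn_gt0//; have := exprn_ege1 2 rho1; lra.
  have : m * (8 * rho ^+ 2)^-1 <= m by rewrite -[leRHS]mulr1 ler_wpM2l// ltW.
  have := @bernoulli_powR R m 2 m_ge1 (ler0n _ 2).
  have : m * (8 * rho ^+ 2)^-1 * (n%:R + 1) = c * D by rewrite natr1.
  by rewrite [X in X = _]mulrDr [X in _ + X = _]mulr1; lra.
have m_inv0 : 0 <= m^-1 by rewrite invr_ge0 ltW.
apply: (le_trans (solution_le_amplitude d_gt1 m_ge1 uP rho1 ub _ k)).
  rewrite bE ler_pM2r ?invr_gt0// -powRmK; last first.
    exact: mulr_ge0 (ltW L0) (ltW qd0).
  apply: powRN_anti base_le => //; rewrite ltr_wpDr ?powR_gt0//.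
  by rewrite mulr_ge0// mulr_ge0 ?(ltW m0)// invr_ge0 mulr_ge0 ?sqr_ge0.
apply: le_trans (powRN_anti m_inv0 _ base_ge) _; first exact: mulr_gt0.
rewrite powRM ?(ltW c0) ?(ltW Dp)//.
rewrite powRmK ?(ltW qd0)// -powR_mulrn ?(ltW q0)// -powRrM [beta * _]mulrC.
by rewrite -powRN.
Qed.

End sup_bound.

(** * Exponential moments *)

Section exponential_moment.
Variables (R : realType) (d : nat).
Implicit Types (k l : lattice d) (lam : R).

Lemma esumZ_le (T : choiceType) (A : set T) (c : R) (f : T -> R) :
    0 <= c -> (forall x, 0 <= f x) ->
  (\esum_(x in A) (c * f x)%:E <= c%:E * \esum_(x in A) (f x)%:E)%E.
Proof.
move=> c0 f0; apply: ge_ereal_sup => /= _ [X [finX XA] <-].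
under eq_fsbigr do rewrite EFinM.
rewrite -ge0_mule_fsumr; last by move=> x; rewrite lee_fin.
apply: lee_wpmul2l; first by rewrite lee_fin.
by apply: ereal_sup_ubound; exists X.
Qed.

(** The sum of $2\cosh(\lambda k_i)$, an eigenfunction of the neighbor average. *)
Definition exp_weight lam k : R :=
  \sum_(i < d) (expR (lam * (k 0 i)%:~R) + expR (- (lam * (k 0 i)%:~R))).

Lemma exp_weight_ge0 lam k : 0 <= exp_weight lam k.
Proof. by apply: sumr_ge0 => i _; rewrite addr_ge0 ?expR_ge0. Qed.

Lemma exp_weight_add lam k (a : int) i :
  exp_weight lam (k + a *: basis i) = exp_weight lam k +
    (expR (lam * a%:~R) - 1) * expR (lam * (k 0 i)%:~R) +
    (expR (- (lam * a%:~R)) - 1) * expR (- (lam * (k 0 i)%:~R)).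
Proof.
rewrite /exp_weight (bigD1 i)//= [in RHS](bigD1 i)//= !coordE eqxx mulr1.
rewrite (eq_bigr (fun j =>
  expR (lam * (k 0 j)%:~R) + expR (- (lam * (k 0 j)%:~R)))); last first.
  by move=> j /negPf ji; rewrite !coordE ji mulr0 addr0.
by rewrite intrD mulrDr opprD !expRD; ring.
Qed.

(** $(\cosh\lambda-1)/d$, the eigenvalue of the discrete Laplacian at [exp_weight]. *)
Definition exp_rate lam : R := (expR lam + expR (- lam) - 2) / (2 * d%:R).

Lemma nbr_avg_exp_weight lam k : (0 < d)%N ->
  nbr_avg (exp_weight lam) k - exp_weight lam k = exp_rate lam * exp_weight lam k.
Proof.
move=> d0; have dR : d%:R != 0 :> R by rewrite pnatr_eq0 -lt0n.
have addb i l : l = k + basis i -> exp_weight lam l = exp_weight lam k +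
    (expR lam - 1) * expR (lam * (k 0 i)%:~R) +
    (expR (- lam) - 1) * expR (- (lam * (k 0 i)%:~R)).
  by move=> ->; rewrite -{1}[basis i]scale1r exp_weight_add mulr1.
have subb i l : l = k - basis i -> exp_weight lam l = exp_weight lam k +
    (expR (- lam) - 1) * expR (lam * (k 0 i)%:~R) +
    (expR lam - 1) * expR (- (lam * (k 0 i)%:~R)).
  move=> ->; rewrite -{1}[basis i]scale1r -scaleNr exp_weight_add.
  by rewrite mulrN mulr1 opprK.
rewrite /nbr_avg (eq_bigr (fun i => 2 * exp_weight lam k +
   (expR lam + expR (- lam) - 2) *
   (expR (lam * (k 0 i)%:~R) + expR (- (lam * (k 0 i)%:~R))))); last first.
  by move=> i _; rewrite (addb i _ erefl) (subb i _ erefl); ring.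
rewrite big_split/= sumr_const card_ord -mulr_sumr -/(exp_weight lam k).
by rewrite /exp_rate -[_ *+ d]mulr_natr; field; rewrite dR.
Qed.

Lemma exp_rate_le lam : (1 < d)%N -> 0 <= lam -> lam <= 2^-1 ->
  0 <= exp_rate lam /\ exp_rate lam <= lam ^+ 2.
Proof.
move=> d1 l0 l2; have d2 : 2 <= d%:R :> R by rewrite ler_nat.
have dd : 0 < 2 * d%:R :> R by rewrite mulr_gt0// ltr0n ltnW.
split.
  rewrite divr_ge0 ?(ltW dd)//.
  have := @expR_ge1Dx R lam; have := @expR_ge1Dx R (- lam); lra.
rewrite ler_pdivrMr//; have := expR_add_expRN_le l0 l2.
have := ler_wpM2l (sqr_ge0 lam) d2; lra.
Qed.

Lemma exp_weight_ge lam k i : 0 <= lam ->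
  expR (lam * (absz (k 0 i))%:R) <= exp_weight lam k.
Proof.
move=> l0; rewrite /exp_weight (bigD1 i)//= -[leLHS]addr0; apply: lerD; last first.
  by apply: sumr_ge0 => j _; rewrite addr_ge0 ?expR_ge0.
rewrite natr_absz; case: (lerP 0 (k 0 i)) => ki.
  by rewrite ger0_norm// lerDl expR_ge0.
by rewrite ltr0_norm// rmorphN mulrN lerDr expR_ge0.
Qed.

End exponential_moment.

(** * Gronwall recursion and exponential tails *)

Section tail_bound.
Variables (R : realType) (d : nat) (m : R).
Hypotheses (d_gt1 : (1 < d)%N) (m_ge1 : 1 <= m).
Local Notation beta := (CM_beta d m).

(** As $u^{m+1}\le su$, the moment grows at most by $1+\theta s\le e^{\theta s}$, with $\theta$ the
    eigenvalue. *)
Lemma exp_moment_step (u : nat -> lattice d -> R) lam n (s : R) :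
    CM_solution m u -> 0 <= exp_rate d lam -> (forall k, u n k `^ m <= s) ->
  (\esum_(k in [set: lattice d]) (u n.+1 k * exp_weight lam k)%:E <=
   (expR (exp_rate d lam * s))%:E *
   \esum_(k in [set: lattice d]) (u n k * exp_weight lam k)%:E)%E.
Proof.
move=> uP th0 us; set th := exp_rate d lam in th0 *.
have u0 k : 0 <= u n k by exact: (solution_ge0 d_gt1 m_ge1 uP).
have w0 := @exp_weight_ge0 R d lam.
have wu0 k : 0 <= u n k * exp_weight lam k by rewrite mulr_ge0.
rewrite (momentS d_gt1 m_ge1 uP _ w0).
apply: le_trans (esumZ_le _ (expR_ge0 _) wu0).
apply: le_esum => k _; rewrite lee_fin nbr_avg_exp_weight; last exact: ltnW.
rewrite -/th -mulr_powRB1 ?addrK//; last by have := m_ge1; lra.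
have -> : u n k * exp_weight lam k + u n k * u n k `^ m * (th * exp_weight lam k) =
  (1 + th * u n k `^ m) * (u n k * exp_weight lam k) by ring.
apply: ler_wpM2r => //; apply: le_trans (expR_ge1Dx _) _.
by rewrite ler_expR ler_wpM2l.
Qed.

(** The sup bound makes $u^m$ of order $n^{-dm\beta}=n^{2\beta-1}$, which sums to order
    $n^{2\beta}$. The summand 1 pays for the first step. *)
Lemma exp_moment_bound : exists2 A : R, 0 <= A &
  forall (u : nat -> lattice d -> R) lam n,
    CM_solution m u -> 0 <= exp_rate d lam -> (0 < n)%N ->
  (\esum_(k in [set: lattice d]) (u n k * exp_weight lam k)%:E <=
   (2 * d%:R * expR (exp_rate d lam * (1 + A * n%:R `^ (2 * beta))))%:E)%E.
Proof.
have [C C0 uC] := solution_sup_bound d_gt1 m_ge1.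
have b0 : 0 < beta := CM_beta_gt0 d m_ge1.
have m0 : 0 <= m by have := m_ge1; lra.
have Cm0 : 0 <= C `^ m := powR_ge0 _ _.
(* By [powR_incr_ge] with exponent $2\beta$, an increment of $An^{2\beta}$ is at least $A\beta
   n^{2\beta-1}$, which equals [s] below. *)
pose A := C `^ m / beta; have A0 : 0 <= A by rewrite divr_ge0// ltW.
exists A => // u lam [//|n] uP th0 _; set th := exp_rate d lam in th0 *.
have dd0 : 0 <= 2 * d%:R :> R by rewrite mulr_ge0.
elim: n => [|n IH].
  have u1 k : u 0%N k `^ m <= 1.
    apply: (@le_trans _ _ (1 `^ m)); last by rewrite powR1.
    apply: ge0_ler_powR; rewrite ?nnegrE//.
      exact: (solution_ge0 d_gt1 m_ge1 uP).
    exact: (solution_le1 d_gt1 m_ge1 uP).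
  apply: le_trans (exp_moment_step uP th0 u1) _.
  rewrite (moment0 uP); last exact: exp_weight_ge0.
  have -> : exp_weight lam (0 : lattice d) = 2 * d%:R.
    rewrite /exp_weight; under eq_bigr do rewrite mxE mulr0 oppr0 expR0.
    by rewrite sumr_const card_ord -[_ *+ d]mulr_natr; ring.
  rewrite -EFinM lee_fin mulrC ler_wpM2l// ler_expR ler_wpM2l//.
  by rewrite lerDl mulr_ge0 ?powR_ge0.
pose s := C `^ m * n.+1%:R `^ (2 * beta - 1).
have us k : u n.+1 k `^ m <= s.
  have -> : s = (C * n.+1%:R `^ (- (d%:R * beta))) `^ m.
    rewrite powRM ?(ltW C0) ?powR_ge0// -powRrM; congr (_ * _ `^ _).
    by have := CM_betaE d m_ge1; lra.
  apply: ge0_ler_powR; rewrite ?nnegrE//.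
  - exact: (solution_ge0 d_gt1 m_ge1 uP).
  - by rewrite mulr_ge0 ?powR_ge0// ltW.
  - exact: uC.
apply: le_trans (exp_moment_step uP th0 us) _.
apply: le_trans (lee_wpmul2l _ IH) _; first by rewrite lee_fin expR_ge0.
rewrite -EFinM lee_fin mulrCA -expRD ler_wpM2l// ler_expR -mulrDr ler_wpM2l//.
have b20 : 0 < 2 * beta by lra.
have := ler_wpM2l A0 (powR_incr_ge b20 (ltn0Sn n)).
have -> : A * (2 * beta / 2 * n.+1%:R `^ (2 * beta - 1)) = s.
  by rewrite /A /s; field; rewrite gt_eqF.
lra.
Qed.

Lemma not_ball_sqnorm (k : lattice d) (rho : R) : 0 < rho ->
  lattice_points (~` euclidean_ball d rho) k -> rho ^+ 2 <= sqnorm R k.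
Proof.
move=> rho0; rewrite /lattice_points /euclidean_ball /euclidean_norm /= => /negP.
rewrite -leNgt (_ : \sum_(i < d) _ = sqnorm R k) => [rk|]; last first.
  by apply: eq_bigr => i _; rewrite mxE.
have -> : sqnorm R k = Num.sqrt (sqnorm R k) ^+ 2 by rewrite sqr_sqrtr ?sqnorm_ge0.
by apply: lerXn2r; rewrite ?nnegrE ?sqrtr_ge0 ?(ltW rho0).
Qed.

(** Chernoff bound with $\lambda=1/(2n^\beta)$: outside the ball some $|k_i|$ is at least
    $rn^\beta/d$, so the weight is at least $e^{r/(2d)}$, while $\lambda^2n^{2\beta}=1/4$ keeps the
    moment bounded. *)
Lemma solution_tail_bound : exists2 C : R, 0 < C &
  forall u, CM_solution m u -> forall (r : R) n, 0 < r -> (0 < n)%N ->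
  (\esum_(k in lattice_points (~` euclidean_ball d (r * n%:R `^ beta)))
     (u n k)%:E <= (C * expR (- r / C))%:E)%E.
Proof.
have [A A0 uA] := exp_moment_bound.
have b0 : 0 < beta := CM_beta_gt0 d m_ge1.
have d0 : 0 < 2 * d%:R :> R by rewrite mulr_gt0// ltr0n ltnW.
pose C := 2 * d%:R * expR (1 + A).
have dC : 2 * d%:R <= C.
  by rewrite /C ler_peMr ?(ltW d0)//; have := @expR_ge1Dx R (1 + A); lra.
exists C; first by apply: lt_le_trans dC.
move=> u uP r n r0 n0; pose q : R := n%:R `^ beta.
have q1 : 1 <= q.
  by rewrite -(powRr0 (n%:R : R)); apply: ler_powR; rewrite ?ler1n ?(ltW b0).
have q0 : 0 < q by lra.
pose lam := (2 * q)^-1.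
have lam0 : 0 <= lam by rewrite invr_ge0; lra.
have lam2 : lam <= 2^-1 by rewrite lef_pV2 ?posrE; lra.
have [th0 th1] := exp_rate_le d_gt1 lam0 lam2.
have u0 k : 0 <= u n k by exact: (solution_ge0 d_gt1 m_ge1 uP).
have w0 := @exp_weight_ge0 R d lam.
have wu0 k : 0 <= u n k * exp_weight lam k by rewrite mulr_ge0.
have MC : (\esum_(k in [set: lattice d]) (u n k * exp_weight lam k)%:E <= C%:E)%E.
  apply: le_trans (uA u lam n uP th0 n0) _.
  rewrite lee_fin /C ler_wpM2l ?(ltW d0)// ler_expR.
  have -> : n%:R `^ (2 * beta) = q ^+ 2 :> R.
    by rewrite -powR_mulrn ?(ltW q0)// -powRrM mulrC.
  have lq : lam ^+ 2 * q ^+ 2 = 4^-1 by rewrite /lam; field; rewrite gt_eqF.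
  have l4 : lam ^+ 2 <= 4^-1 by rewrite expr2; nra.
  have : 0 <= 1 + A * q ^+ 2 by rewrite addr_ge0// mulr_ge0// sqr_ge0.
  move=> /ler_wpM2r/(_ _ _ th1)/le_trans; apply.
  have -> : lam ^+ 2 * (1 + A * q ^+ 2) = lam ^+ 2 + A * (lam ^+ 2 * q ^+ 2) by ring.
  by rewrite lq; lra.
apply: (@le_trans _ _ ((expR (- (r / (2 * d%:R))))%:E * C%:E)%E); last first.
  rewrite -EFinM lee_fin mulrC ler_wpM2l ?(le_trans (ltW d0))// ler_expR mulNr lerN2.
  by rewrite ler_wpM2l ?(ltW r0)// lef_pV2 ?posrE// (lt_le_trans d0).
apply: le_trans (lee_wpmul2l _ MC); last by rewrite lee_fin expR_ge0.
apply: le_trans (esumZ_le _ (expR_ge0 _) wu0).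
pose f k := (expR (- (r / (2 * d%:R))) * (u n k * exp_weight lam k))%:E.
apply: (@le_trans _ _ (\esum_(k in
   lattice_points (~` euclidean_ball d (r * q))) f k)%E); last first.
  by apply: esum_subset => // k; rewrite lee_fin mulr_ge0 ?expR_ge0.
have rq0 : 0 < r * q by rewrite mulr_gt0.
apply: le_esum => k /(not_ball_sqnorm rq0)/(sqnorm_large_coord rq0)[i ki].
rewrite lee_fin mulrCA ler_peMr// expRN mulrC ler_pdivlMr ?expR_gt0// mul1r.
apply: le_trans (exp_weight_ge k i lam0); rewrite ler_expR.
rewrite ler_pdivrMr//.
have -> : lam * (absz (k 0 i))%:R * (2 * d%:R) = d%:R * (absz (k 0 i))%:R / q.
  by rewrite /lam; field; rewrite gt_eqF.
by rewrite ler_pdivlMr.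
Qed.

End tail_bound.

(** * Total variation *)

(** Only the first step can go up, by at most [S]; the later ones telescope to at most [S]. *)
Lemma unimodal_variation_le (R : realDomainType) (f : nat -> R) (S : R) N :
    (forall t, 0 <= f t /\ f t <= S) -> (forall t, f t.+2 <= f t.+1) ->
  \sum_(t < N) `|f t.+1 - f t| <= 2 * S.
Proof.
move=> f0S fdec; case: N => [|N].
  by rewrite big_ord0; have [] := f0S 0%N; lra.
rewrite big_ord_recl /=.
have -> : \sum_(t < N) `|f (bump 0 t).+1 - f (bump 0 t)| = f 1%N - f N.+1.
  elim: N => [|N IH]; first by rewrite big_ord0 subrr.
  rewrite big_ord_recr /= IH /bump /= !add1n ler0_norm ?subr_le0//.
  by ring.
have [f00 f0] := f0S 0%N; have [f10 f1] := f0S 1%N; have [fN _] := f0S N.+1.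
have : `|f 1%N - f 0%N| <= S by rewrite ler_norml; apply/andP; split; lra.
lra.
Qed.

Section edges.
Variables (d : nat) (N : nat).
Implicit Types (k l : lattice d) (i : 'I_d).

(** Direction, orientation bit, reflection bit, and the $d-1$ transverse coordinates shifted by
    [N]. *)
Definition line_index : Type := 'I_d * (bool * bool) * {ffun 'I_d.-1 -> 'I_(2 * N).+1}.
HB.instance Definition _ := Finite.on line_index.

Definition line_point i (b : {ffun 'I_d.-1 -> 'I_(2 * N).+1}) (t : nat) :
    lattice d :=
  \row_j (if unlift i j is Some j' then (b j')%:Z - N%:Z else t%:Z).

Lemma line_pointS i b t : line_point i b t.+1 = line_point i b t + basis i.
Proof.
apply/eq_lattice => j; rewrite coordE basisE !mxE.
case: unliftP => [j' ->|->]; last by rewrite eqxx /= -addn1 PoszD.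
by rewrite eq_sym (negPf (neq_lift _ _)) addr0.
Qed.

(* Every edge inside the cube [-N, N]^d is, up to orientation and the
   reflection [x_i -> - x_i], an edge from level [t >= 0] to level [t + 1] of a
   line in direction [i]. *)
Definition line_edge (x : line_index * 'I_N) : lattice d * lattice d :=
  let: (i, (o, s), b) := x.1 in
  let v := flip_signs (fun j => s && (j == i)) (line_point i b x.2) in
  let w := flip_signs (fun j => s && (j == i)) (line_point i b x.2.+1) in
  if o then (w, v) else (v, w).

Lemma line_edge_cover k l :
    (forall j, (absz (k 0%R j) <= N)%N) -> (forall j, (absz (l 0%R j) <= N)%N) ->
    lattice_neighbor k l ->
  exists x, line_edge x = (k, l).
Proof.
move=> kN lN /neighborP[[i c]] kl.
have kj j : j != i -> k 0 j = l 0 j.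
  by move=> /negPf ji; rewrite kl; case: c {kl}; rewrite /signed_basis /= !coordE ji;
     rewrite ?oppr0 addr0.
have ki : k 0 i = l 0 i + (if c then 1 else -1).
  by rewrite kl; case: c {kl}; rewrite /signed_basis /= !coordE eqxx.
pose b := [ffun j' : 'I_d.-1 => inord (absz (k 0 (lift i j') + N%:Z)) : 'I_(2 * N).+1].
have bE j' : (b j')%:Z - N%:Z = k 0 (lift i j').
  by rewrite ffunE inordK; have := kN (lift i j'); lia.
(* [o] tells whether [k] is the higher endpoint, [s] whether to reflect; adjacent integers never
   have strictly opposite signs. *)
pose o := (absz (l 0%R i) < absz (k 0%R i))%N.
pose s := (k 0 i < 0) || (l 0 i < 0).
pose t := minn (absz (k 0 i)) (absz (l 0 i)).
have tN : (t < N)%N.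
  by rewrite /t; have := kN i; have := lN i; move: ki; case: (c); lia.
have level (a : nat) (h : lattice d) : (forall j, j != i -> h 0 j = k 0 j) ->
    h 0 i = (if s then - a%:Z else a%:Z) ->
    flip_signs (fun j => s && (j == i)) (line_point i b a) = h.
  move=> hk hi; apply/eq_lattice => j; rewrite !mxE.
  case: unliftP => [j' ->|->]; last by rewrite eqxx andbT hi.
  have ji : lift i j' != i by rewrite eq_sym neq_lift.
  by rewrite (negPf ji) andbF bE hk.
exists ((i, (o, s), b), Ordinal tN); rewrite /line_edge /=.
have lk j : j != i -> l 0 j = k 0 j by move=> /kj.
case: ifP => oE; congr (_, _); apply: level => //; move: ki oE;
  rewrite /o /s /t; case: (c) => ki oE; case: ifP => sE; lia.
Qed.

End edges.

Section variation_bound.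
Variables (R : realType) (d : nat) (m : R).
Hypotheses (d_gt1 : (1 < d)%N) (m_ge1 : 1 <= m).
Local Notation beta := (CM_beta d m).

Lemma ball_sqnorm (k : lattice d) (rho : R) :
  lattice_points (euclidean_ball d rho) k -> sqnorm R k < rho ^+ 2 /\ 0 < rho.
Proof.
rewrite /lattice_points /euclidean_ball /euclidean_norm /=.
rewrite (_ : \sum_(i < d) _ = sqnorm R k) => [kr|]; last first.
  by apply: eq_bigr => i _; rewrite mxE.
have rho0 := le_lt_trans (sqrtr_ge0 _) kr; split=> //.
by rewrite -(sqr_sqrtr (sqnorm_ge0 R k)) !expr2 ltr_pM ?sqrtr_ge0.
Qed.

Lemma ball_coord (k : lattice d) (rho : R) j :
  lattice_points (euclidean_ball d rho) k -> (absz (k 0 j))%:R < rho.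
Proof.
move=> /ball_sqnorm [kr rho0]; have := le_lt_trans (sqr_coord_le_sqnorm R k j) kr.
rewrite natr_absz intr_norm -[_%:~R ^+ 2]real_normK ?num_real//.
by apply: contraTT; rewrite -!leNgt => h; apply: lerXn2r; rewrite ?nnegrE// ltW.
Qed.

(** Flips preserve the solution, so each indexed line contributes at most $2S$ by unimodality; the
    first factor is the number of indices. *)
Lemma solution_variation_le (u : nat -> lattice d -> R) n N (S : R) :
    CM_solution m u -> (0 < n)%N -> (forall k, u n k <= S) ->
  \sum_(x : line_index d N * 'I_N)
     `|u n (line_edge x).2 - u n (line_edge x).1| <=
  (d * 4 * (2 * N).+1 ^ d.-1)%:R * (2 * S).
Proof.
move=> uP n0 uS.
have h (g : line_index d N) (t : 'I_N) :
    `|u n (line_edge (g, t)).2 - u n (line_edge (g, t)).1| =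
    `|u n (line_point g.1.1 g.2 t.+1) - u n (line_point g.1.1 g.2 t)|.
  case: g => [[i [c s]] b]; rewrite /line_edge /=.
  by case: c => /=; rewrite !(solution_flip uP)// distrC.
have -> : (d * 4 * (2 * N).+1 ^ d.-1)%N = #|{: line_index d N}|.
  by rewrite !card_prod !card_bool card_ffun !card_ord.
rewrite mulr_natl -sumr_const.
rewrite -(pair_bigA _ (fun g t =>
  `|u n (line_edge (g, t)).2 - u n (line_edge (g, t)).1|)) /=.
apply: ler_sum => g _; under eq_bigr do rewrite h.
apply: (@unimodal_variation_le _ (fun t => u n (line_point g.1.1 g.2 t))).
  by move=> t; split=> //; exact: (solution_ge0 d_gt1 m_ge1 uP).
(* Reflection needs a positive time, and level [t.+2] meets the condition $k_i\ge2$. *)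
case: n n0 {uS h} => // n _ t.
rewrite [line_point _ _ t.+1](_ : _ =
   line_point g.1.1 g.2 t.+2 - 1%:Z *: basis g.1.1); last first.
  by rewrite scale1r [line_point _ _ t.+2]line_pointS addrK.
apply: (solution_coord_le d_gt1 m_ge1 uP) => //.
by rewrite mxE unlift_none; lia.
Qed.

(** About $(rn^\beta)^{d-1}$ lines, each of variation of order $n^{-d\beta}$, leave
    $r^{d-1}n^{-\beta}$. *)
Lemma solution_TV_bound : exists2 C : R, 0 < C &
  forall u, CM_solution m u -> forall (r : R) n, 0 < r -> (0 < n)%N ->
  (discrete_TV (lattice_points (euclidean_ball d (r * n%:R `^ beta))) (u n)
   <= (C * r ^+ d.-1 * n%:R `^ (- beta))%:E)%E.
Proof.
have [C C0 uC] := solution_sup_bound d_gt1 m_ge1.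
pose K : R := 4 * d%:R * 5 ^+ d.-1 * C.
have d0 : (0 < d)%N by exact: ltnW.
have K0 : 0 < K by rewrite !mulr_gt0 ?exprn_gt0 ?ltr0n.
exists K => // u uP r n r0 n0; pose q : R := n%:R `^ beta.
have q0 : 0 < q by rewrite powR_gt0// ltr0n.
set rho := r * _; have rho0 : 0 < rho by rewrite mulr_gt0.
have rhs0 : 0 <= K * r ^+ d.-1 * n%:R `^ (- beta).
  by rewrite mulr_ge0 ?powR_ge0// mulr_ge0 ?exprn_ge0 ?(ltW K0) ?(ltW r0).
(* An open ball of radius at most 1 contains no lattice point but 0. The bound $2N+1\le5\rho$ below
   relies on $\rho>1$. *)
rewrite /discrete_TV; have [rho1|rho1] := leP rho 1.
  rewrite esum1 ?mule0 ?lee_fin// => -[k l] /= [kB lB kl].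
  have B0 h : lattice_points (euclidean_ball d rho) h -> h = 0.
    move=> hB; apply/eq_lattice => j; have := lt_le_trans (ball_coord j hB) rho1.
    by rewrite ltrn1 mxE => /eqP; lia.
  by rewrite (B0 _ kB) (B0 _ lB) subrr normr0.
pose N := (Num.truncn rho).+1.
have /andP[Nle ltN] := truncn_itv (ltW rho0).
have N2 : (2 * N).+1%:R <= 5 * rho.
  have -> : (2 * N).+1 = (2 * Num.truncn rho + 3)%N by rewrite /N; lia.
  by rewrite natrD natrM; lra.
set S := C * n%:R `^ (- (d%:R * beta)).
have uS k : u n k <= S by exact: uC.
have S0 : 0 <= S by rewrite mulr_ge0 ?powR_ge0 ?(ltW C0).
apply: (@le_trans _ _ ((2^-1)%:E * (\sum_(x : line_index d N * 'I_N)
     `|u n (line_edge x).2 - u n (line_edge x).1|)%:E)%E).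
  apply: lee_wpmul2l; first by rewrite lee_fin invr_ge0.
  rewrite -sumEFin.
  apply: (esum_le_cover (g := @line_edge d N)
    (f := fun uv => `|u n uv.2 - u n uv.1|%:E)) => //.
  move=> [k l] /= [kB lB kl].
  have cN h j : lattice_points (euclidean_ball d rho) h -> (absz (h 0%R j) <= N)%N.
    move=> hB; have := lt_trans (ball_coord j hB) ltN.
    by rewrite ltr_nat => /ltnW.
  by apply: line_edge_cover => // j; exact: cN.
rewrite -EFinM lee_fin.
apply: le_trans (ler_wpM2l _ (solution_variation_le N uP n0 uS)) _.
  by rewrite invr_ge0.
have -> : K * r ^+ d.-1 * n%:R `^ (- beta) =
    4 * d%:R * (5 * rho) ^+ d.-1 * S.
  have -> : n%:R `^ (- beta) = q ^+ d.-1 * n%:R `^ (- (d%:R * beta)).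
    rewrite -powR_mulrn ?(ltW q0)// -powRrM -powRD; last first.
      by apply/implyP => _; rewrite pnatr_eq0 -lt0n.
    have dE : d%:R = d.-1%:R + 1 :> R by rewrite natr1 prednK.
    by congr (_ `^ _); rewrite dE; ring.
  by rewrite /K /S /rho -/q !exprMn; ring.
rewrite !natrM natrX.
have -> : 2^-1 * (d%:R * 4 * (2 * N).+1%:R ^+ d.-1 * (2 * S)) =
  4 * d%:R * (2 * N).+1%:R ^+ d.-1 * S :> R by field.
rewrite ler_wpM2r// ler_wpM2l ?mulr_ge0//.
by apply: lerXn2r; rewrite ?nnegrE// mulr_ge0// ltW.
Qed.

End variation_bound.

Theorem theorem1p2 (R : realType) (d : nat) (m : R)
    (hd : (1 < d)%N) (hm : 1 <= m) :
  exists C : R, 0 < C /\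
    forall (dsp : measure_display) (T : measurableType dsp)
      (P : probability T R) (X : nat -> T -> lattice d),
    CM_distributed m P X ->
    [/\ forall (k : lattice d) (n : nat), (0 < n)%N ->
          lattice_pmf P X k n <= C * n%:R `^ (- (d%:R * CM_beta d m)),
        forall (r : R) (n : nat), 0 < r -> (0 < n)%N ->
          (\esum_(k in lattice_points
                         (~` euclidean_ball d (r * n%:R `^ CM_beta d m)))
             (lattice_pmf P X k n)%:E <= (C * expR (- r / C))%:E)%E
      & forall (r : R) (n : nat), 0 < r -> (0 < n)%N ->
          (discrete_TV
             (lattice_points (euclidean_ball d (r * n%:R `^ CM_beta d m)))
             (fun k => lattice_pmf P X k n)
           <= (C * r ^+ d.-1 * n%:R `^ (- CM_beta d m))%:E)%E].
Proof.
have [C1 C10 h1] := solution_sup_bound hd hm.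
have [C2 C20 h2] := solution_tail_bound hd hm.
have [C3 C30 h3] := solution_TV_bound hd hm.
(* All three right-hand sides increase with the constant, $e^{-r/C}$ included. *)
pose C := C1 + C2 + C3; exists C; split; first by rewrite !addr_gt0.
have C1C : C1 <= C by rewrite /C; lra.
have C2C : C2 <= C by rewrite /C; lra.
have C3C : C3 <= C by rewrite /C; lra.
move=> dsp T P X /(CM_distributed_solution (ltnW hd)) uP; split.
- move=> k n n0; apply: le_trans (h1 _ uP n k n0) _.
  by rewrite ler_wpM2r ?powR_ge0.
- move=> r n r0 n0; apply: le_trans (h2 _ uP r n r0 n0) _.
  rewrite lee_fin; apply: ler_pM => //; rewrite ?(ltW C20) ?expR_ge0//.
  rewrite ler_expR !mulNr lerN2 ler_wpM2l ?(ltW r0)// lef_pV2 ?posrE//.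
  exact: lt_le_trans C2C.
- move=> r n r0 n0; apply: le_trans (h3 _ uP r n r0 n0) _.
  by rewrite lee_fin !ler_wpM2r ?powR_ge0 ?exprn_ge0 ?(ltW r0).
Qed.
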